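(* In the setting described in the context, let $F\in V^*$ be given by $$F(v):=\int_\Omega G:D^m v\,dx+\int_\Omega g v\,dx+\sum_{a\in A}\beta(a)v(a)\quad(v\in V),$$ with $G\in L^2(\Omega;\mathbb R^{2^m})$, $g\in L^2(\Omega)$, a finite set $A$ of interior vertices of $\mathcal T$, and $\beta(a)\in\mathbb R$ for $a\in A$. Let $u\in V$ solve $a(u,v)=F(v)$ for all $v\in V$ and let $u_{\mathrm{nc}}\in V_{\mathrm{nc}}$ solve $a_{\mathrm{pw}}(u_{\mathrm{nc}},v_{\mathrm{nc}})=F(Jv_{\mathrm{nc}})$ for all $v_{\mathrm{nc}}\in V_{\mathrm{nc}}$. Then (a) $\displaystyle |\!|\!| u-Ju_{\mathrm{nc}}|\!|\!|\le\sqrt{1+\Lambda_0^2}\,\|G-\Pi_0G\|+\sqrt{\left(\kappa_m\|h_{\mathcal T}^mg\|+|\!|\!| u_{\mathrm{nc}}-Ju_{\mathrm{nc}}|\!|\!|_{\mathrm{pw}}\right)^2+\kappa_m^2\Lambda_0^2\,\mathrm{osc}_m^2(g,\mathcal T)},$ (b) $\displaystyle |\!|\!| u-u_{\mathrm{nc}}|\!|\!|_{\mathrm{pw}}\le\sqrt{2\left(|\!|\!| u_{\mathrm{nc}}-Ju_{\mathrm{nc}}|\!|\!|_{\mathrm{pw}}^2+\mathrm{apx}(F)^2\right)},$ where $\mathrm{apx}(F):=(1+\Lambda_{\mathrm J})\|G-\Pi_0G\|+\kappa_m\|h_{\mathcal T}^mg\|+\kappa_m\Lambda_{\mathrm J}\,\mathrm{osc}_m(g,\mathcal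 T)$.
   Context: Let $m\in\mathbb N$ (the paper's examples are Crouzeix–Raviart, $m=1$, and Morley, $m=2$), let $\Omega\subset\mathbb R^2$ be a planar bounded Lipschitz domain with polygonal boundary, $V:=H^m_0(\Omega)$, $V^*=H^{-m}(\Omega)$, $a(v,w):=\int_\Omega D^m v:D^m w\,dx$ for $v,w\in V$, and $|\!|\!| v|\!|\!|:=a(v,v)^{1/2}$. Write $\|\cdot\|:=\|\cdot\|_{L^2(\Omega)}$. Let $\mathcal T$ be a shape-regular triangulation of $\Omega$ into triangles, $P_k(\mathcal T)$ the space of piecewise polynomials of total degree at most $k$, $\Pi_k$ the $L^2$ projection onto $P_k(\mathcal T)$ (componentwise for tensor fields), $H^m(\mathcal T):=\{v\in L^2(\Omega): v|_T\in H^m(T)\ \forall T\in\mathcal T\}$, $D^m_{\mathrm{pw}}$ the piecewise $m$-th derivative, and $h_{\mathcal T}\in P_0(\mathcal T)$ with $h_{\mathcal T}|_T=\mathrm{diam}(T)$. Set $a_{\mathrm{pw}}(v,w):=\int_\Omega D^m_{\mathrm{pw}}v:D^m_{\mathrm{pw}}w\,dx$ for $v,w\in H^m(\mathcal T)$, $|\!|\!| v|\!|\!|_{\mathrm{pw}}:=a_{\mathrm{pw}}(v,v)^{1/2}$, and $\mathrm{osc}_m(g,\mathcal T):=\|h_{\mathcal T}^m(g-\Pi_mg)\|$. $V_{\mathrm{nc}}\subset P_m(\mathcal T)$ is a nontrivial linear subspace on which $|\!|\!|\cdot|\!|\!|_{\mathrm{pw}}$ is a norm. There are an interpolation operator $I_{\mathrm{nc}}:V\to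 V_{\mathrm{nc}}$ and a constant $\kappa_m>0$ with, for all $v\in V$ and $w_m\in P_m(\mathcal T)$: $a_{\mathrm{pw}}(v-I_{\mathrm{nc}}v,w_m)=0$; $\|h_{\mathcal T}^{-m}(v-I_{\mathrm{nc}}v)\|\le\kappa_m|\!|\!| v-I_{\mathrm{nc}}v|\!|\!|_{\mathrm{pw}}$; and $D^m_{\mathrm{pw}}(v-I_{\mathrm{nc}}v)$ is $L^2$-orthogonal to $P_0(\mathcal T;\mathbb R^{2^m})$. There are a linear operator $J:V_{\mathrm{nc}}\to V$ and a constant $\Lambda_{\mathrm J}$ such that for all $v_{\mathrm{nc}}\in V_{\mathrm{nc}}$ and $v\in V$: $I_{\mathrm{nc}}Jv_{\mathrm{nc}}=v_{\mathrm{nc}}$; $|\!|\!| v_{\mathrm{nc}}-Jv_{\mathrm{nc}}|\!|\!|_{\mathrm{pw}}\le\Lambda_{\mathrm J}|\!|\!| v_{\mathrm{nc}}-v|\!|\!|_{\mathrm{pw}}$; and $v_{\mathrm{nc}}-Jv_{\mathrm{nc}}$ is $L^2(\Omega)$-orthogonal to $P_m(\mathcal T)$. Definition: $\Lambda_0:=\sup_{v_{\mathrm{nc}}\in V_{\mathrm{nc}}\setminus\{0\}}|\!|\!| v_{\mathrm{nc}}-Jv_{\mathrm{nc}}|\!|\!|_{\mathrm{pw}}/|\!|\!| v_{\mathrm{nc}}|\!|\!|_{\mathrm{pw}}$. Point forces: $A=\emptyset$ if $m=1$. If $A\ne\emptyset$ (so $m\ge2$ and point evaluation is bounded on $V$),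 all functions in $V_{\mathrm{nc}}$ are continuous at the interior vertices of $\mathcal T$ and $(I_{\mathrm{nc}}v)(a)=v(a)$ for all $v\in V$ and all $a\in A$ (as for the Morley element). *)

(* Defs.v *)
(* Points of the plane are pairs (R * R), so that the
   product measure is available.  Elements of L^2 and of Sobolev spaces are
   represented by functions on the whole plane of which only the restriction
   to the relevant open set matters, and which are identified when they agree
   almost everywhere there.  Measurability is Borel measurability; every class
   has Borel representatives. *)
From HB Require Import structures.
From mathcomp Require Import all_boot all_order all_algebra finmap.
From mathcomp Require Import all_classical all_reals all_analysis.

Set Implicit Arguments.
Unset Strict Implicit.
Unset Printing Implicit Defensive.

Import Order.TTheory GRing.Theory Num.Theory.
Import numFieldNormedType.Exports.

#[global] Open Scope classical_set_scope.
#[global] Open Scope ring_scope.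

Notation plane R := (R * R)%type.

Definition leb2 (R : realType) :=
  product_measure1 (@lebesgue_measure R) (@lebesgue_measure R).

Definition L2 (R : realType) (U : set (plane R)) (f : plane R -> R) : Prop :=
  (f \_ U : plane R -> R) \in Lfun (@leb2 R) 2%:E.

Definition aeeq (R : realType) (U : set (plane R)) (f g : plane R -> R) : Prop :=
  {ae @leb2 R, forall x, U x -> f x = g x}.

Definition l2dot (R : realType) (U : set (plane R)) (f g : plane R -> R) : R :=
  Rintegral (@leb2 R) U (fun x => f x * g x).

Definition l2norm (R : realType) (U : set (plane R)) (f : plane R -> R) : R :=
  Num.sqrt (l2dot U f f).

(* A field of k-tensors over R^2 has the 2^k components indexed by the words
   of length k over {0, 1}. *)
Definition tfield (R : realType) (k : nat) := k.-tuple 'I_2 -> plane R -> R.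

Definition l2dotT (R : realType) (k : nat) (U : set (plane R))
    (P Q : tfield R k) : R :=
  \sum_(s : k.-tuple 'I_2) l2dot U (P s) (Q s).

Definition l2normT (R : realType) (k : nat) (U : set (plane R))
    (P : tfield R k) : R :=
  Num.sqrt (l2dotT U P P).

Definition e2 (R : realType) (j : 'I_2) : plane R :=
  ((j == ord0)%:R, (j != ord0)%:R).

Definition pder (R : realType) (s : seq 'I_2) (f : plane R -> R) : plane R -> R :=
  foldr (fun j g => 'D_(e2 R j) g) f s.

Definition smooth (R : realType) (f : plane R -> R) : Prop :=
  forall (s : seq 'I_2) (x : plane R), differentiable (pder s f) x.

(* C_c^oo(U), extended by zero to the plane *)
Definition test_fun (R : realType) (U : set (plane R)) (phi : plane R -> R) : Prop :=
  smooth phi /\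
  exists K : set (plane R),
    [/\ compact K, K `<=` U & forall x, ~ K x -> phi x = 0].

Definition is_weak_der (R : realType) (U : set (plane R)) (s : seq 'I_2)
    (v w : plane R -> R) : Prop :=
  L2 U w /\
  forall phi, test_fun U phi ->
    l2dot U v (pder s phi) = (-1) ^+ size s * l2dot U w phi.

(* the weak derivative of v on U along s (0 if there is none in L^2(U)) *)
Definition wD (R : realType) (U : set (plane R)) (s : seq 'I_2)
    (v : plane R -> R) : plane R -> R :=
  xget (fun _ => 0) [set w | is_weak_der U s v w].

Definition wDm (R : realType) (m : nat) (U : set (plane R)) (v : plane R -> R) :
    tfield R m :=
  fun s => wD U (tval s) v.

Definition Hm (R : realType) (m : nat) (U : set (plane R)) (v : plane R -> R) : Prop :=
  L2 U v /\
  forall s : seq 'I_2, (size s <= m)%N -> exists w, is_weak_der U s v w.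

Definition Hm_norm (R : realType) (m : nat) (U : set (plane R)) (v : plane R -> R) : R :=
  Num.sqrt (\sum_(k < m.+1) l2dotT U (@wDm R k U v) (@wDm R k U v)).

(* H^m_0(U): the closure of C_c^oo(U) in H^m(U) *)
Definition Hm0 (R : realType) (m : nat) (U : set (plane R)) (v : plane R -> R) : Prop :=
  Hm m U v /\
  forall eps : R, 0 < eps ->
    exists2 phi, test_fun U phi & Hm_norm m U (v \- phi) < eps.

Definition a_form (R : realType) (m : nat) (U : set (plane R)) (v w : plane R -> R) : R :=
  l2dotT U (@wDm R m U v) (@wDm R m U w).

Definition enorm (R : realType) (m : nat) (U : set (plane R)) (v : plane R -> R) : R :=
  Num.sqrt (a_form m U v v).

(* Point value of a class of functions on U: the value at a of a representative
   that is continuous at a (unique for a in the open set U). *)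
Definition has_ptval (R : realType) (U : set (plane R)) (v : plane R -> R)
    (a : plane R) (c : R) : Prop :=
  exists w : plane R -> R,
    [/\ aeeq U v w, {for a, continuous w} & w a = c].

Definition ptval (R : realType) (U : set (plane R)) (v : plane R -> R)
    (a : plane R) : R :=
  xget 0 [set c | has_ptval U v a c].

(* v(a) = w(a), both point values being defined *)
Definition same_ptval (R : realType) (U : set (plane R)) (v w : plane R -> R)
    (a : plane R) : Prop :=
  exists c, has_ptval U v a c /\ has_ptval U w a c.

Definition edist (R : realType) (x y : plane R) : R :=
  Num.sqrt ((x.1 - y.1) ^+ 2 + (x.2 - y.2) ^+ 2).

Definition diam (R : realType) (S : set (plane R)) : R :=
  sup [set edist z.1 z.2 | z in S `*` S].

Definition frontier (R : realType) (S : set (plane R)) : set (plane R) :=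
  closure S `\` S°.

Definition segment2 (R : realType) (p q : plane R) : set (plane R) :=
  [set p + t *: (q - p) | t in `[0, 1]].

(* Near every boundary point z, in orthonormal coordinates with axes (c, s) and
   (- s, c), the set is the part above the graph of a Lipschitz function. *)
Definition lipschitz_boundary (R : realType) (U : set (plane R)) : Prop :=
  forall z, frontier U z ->
    exists (c s r L : R) (gamma : R -> R),
      [/\ c ^+ 2 + s ^+ 2 = 1,
          0 < r,
          forall t t' : R, `|gamma t - gamma t'| <= L * `|t - t'| &
          forall x, edist x z < r ->
            (U x <-> gamma (c * x.1 + s * x.2) < c * x.2 - s * x.1)].

Definition polygonal_boundary (R : realType) (U : set (plane R)) : Prop :=
  exists (n : nat) (p q : 'I_n -> plane R),
    frontier U = \bigcup_(i in [set: 'I_n]) segment2 (p i) (q i).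

Definition polygonal_lipschitz_domain (R : realType) (U : set (plane R)) : Prop :=
  [/\ open U, connected U, U !=set0 & bounded_set U] /\
  [/\ lipschitz_boundary U & polygonal_boundary U].

Definition triangle (R : realType) (t : 'I_3 -> plane R) : set (plane R) :=
  [set x | exists lam : 'I_3 -> R,
     [/\ forall k, 0 <= lam k, \sum_k lam k = 1 & x = \sum_k lam k *: t k]].

Definition nondegenerate (R : realType) (t : 'I_3 -> plane R) : Prop :=
  let u := t (inord 1) - t ord0 in
  let v := t (inord 2) - t ord0 in
  u.1 * v.2 - u.2 * v.1 != 0.

(* conforming triangulation, given by the vertices of its n triangles: two
   distinct triangles share nothing, one vertex, or one edge *)
Definition triangulation (R : realType) (U : set (plane R)) (n : nat)
    (tri : 'I_n -> 'I_3 -> plane R) : Prop :=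
  [/\ forall i, nondegenerate (tri i),
      \bigcup_(i in [set: 'I_n]) triangle (tri i) = closure U &
      forall i j : 'I_n, i != j ->
        let I := triangle (tri i) `&` triangle (tri j) in
        [\/ I = set0,
            exists k l, tri i k = tri j l /\ I = [set tri i k] |
            exists k k' l l',
              [/\ k != k', tri i k = tri j l, tri i k' = tri j l' &
                  I = segment2 (tri i k) (tri i k')]]].

(* every triangle T contains a disc of radius rho with diam T <= sigma * rho *)
Definition shape_regular (R : realType) (sigma : R) (n : nat)
    (tri : 'I_n -> 'I_3 -> plane R) : Prop :=
  forall i, exists (c : plane R) (rho : R),
    [/\ 0 < rho, [set x | edist x c < rho] `<=` triangle (tri i) &
        diam (triangle (tri i)) <= sigma * rho].

Definition interior_vertex (R : realType) (U : set (plane R)) (n : nat)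
    (tri : 'I_n -> 'I_3 -> plane R) (a : plane R) : Prop :=
  U a /\ exists i k, a = tri i k.

(* h_T, extended by 0 to the null set of points in no open triangle (as is
   wDm_pw below) *)
Definition mesh (R : realType) (n : nat) (tri : 'I_n -> 'I_3 -> plane R) :
    plane R -> R :=
  fun x => \sum_(i < n) (cst (diam (triangle (tri i))) \_ (triangle (tri i))°) x.

Definition wDm_pw (R : realType) (m : nat) (n : nat)
    (tri : 'I_n -> 'I_3 -> plane R) (v : plane R -> R) : tfield R m :=
  fun s x => \sum_(i < n) (@wDm R m (triangle (tri i))° v s \_ (triangle (tri i))°) x.

Definition a_pw (R : realType) (m : nat) (U : set (plane R)) (n : nat)
    (tri : 'I_n -> 'I_3 -> plane R) (v w : plane R -> R) : R :=
  l2dotT U (wDm_pw (m := m) tri v) (wDm_pw (m := m) tri w).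

Definition enorm_pw (R : realType) (m : nat) (U : set (plane R)) (n : nat)
    (tri : 'I_n -> 'I_3 -> plane R) (v : plane R -> R) : R :=
  Num.sqrt (a_pw m U tri v v).

Definition poly2 (R : realType) (k : nat) (c : nat -> nat -> R) (x : plane R) : R :=
  \sum_(i < k.+1) \sum_(j < k.+1 | (i + j <= k)%N) c i j * x.1 ^+ i * x.2 ^+ j.

(* P_k(T), as a subspace of L^2(U) *)
Definition Pk (R : realType) (k : nat) (U : set (plane R)) (n : nat)
    (tri : 'I_n -> 'I_3 -> plane R) (f : plane R -> R) : Prop :=
  L2 U f /\
  forall i, exists c, aeeq (triangle (tri i))° f (poly2 k c).

Definition L2proj (R : realType) (k : nat) (U : set (plane R)) (n : nat)
    (tri : 'I_n -> 'I_3 -> plane R) (g : plane R -> R) : plane R -> R :=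
  xget (fun _ => 0)
    [set p | Pk k U tri p /\ forall q, Pk k U tri q -> l2dot U (g \- p) q = 0].

Definition osc (R : realType) (m : nat) (U : set (plane R)) (n : nat)
    (tri : 'I_n -> 'I_3 -> plane R) (g : plane R -> R) : R :=
  l2norm U (fun x => mesh tri x ^+ m * (g x - L2proj m U tri g x)).

Definition osc0T (R : realType) (m : nat) (U : set (plane R)) (n : nat)
    (tri : 'I_n -> 'I_3 -> plane R) (G : tfield R m) : R :=
  l2normT U (fun s => G s \- L2proj 0 U tri (G s)).

Definition nc_space (R : realType) (m : nat) (U : set (plane R)) (n : nat)
    (tri : 'I_n -> 'I_3 -> plane R) (Vnc : set (plane R -> R)) : Prop :=
  [/\ Vnc `<=` Pk m U tri,
      Vnc (fun _ => 0) /\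
      (forall (c : R) v w, Vnc v -> Vnc w -> Vnc (fun x => c * v x + w x)),
      exists2 v, Vnc v & ~ aeeq U v (fun _ => 0) &
      forall v, Vnc v -> enorm_pw m U tri v = 0 -> aeeq U v (fun _ => 0)].

Definition nc_interpolation (R : realType) (m : nat) (U : set (plane R)) (n : nat)
    (tri : 'I_n -> 'I_3 -> plane R) (Vnc : set (plane R -> R)) (kappa : R)
    (Inc : (plane R -> R) -> plane R -> R) : Prop :=
  forall v, Hm0 m U v ->
    [/\ Vnc (Inc v),
        forall w, Pk m U tri w -> a_pw m U tri (v \- Inc v) w = 0,
        l2norm U (fun x => mesh tri x ^- m * (v x - Inc v x))
          <= kappa * enorm_pw m U tri (v \- Inc v) &
        forall q : tfield R m, (forall s, Pk 0 U tri (q s)) ->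
          l2dotT U (wDm_pw tri (v \- Inc v)) q = 0].

Definition nc_companion (R : realType) (m : nat) (U : set (plane R)) (n : nat)
    (tri : 'I_n -> 'I_3 -> plane R) (Vnc : set (plane R -> R))
    (Inc : (plane R -> R) -> plane R -> R) (LambdaJ : R)
    (J : (plane R -> R) -> plane R -> R) : Prop :=
  (forall (c : R) v w, Vnc v -> Vnc w ->
     aeeq U (J (fun x => c * v x + w x)) (fun x => c * J v x + J w x)) /\
  forall vnc, Vnc vnc ->
    [/\ Hm0 m U (J vnc),
        aeeq U (Inc (J vnc)) vnc,
        forall v, Hm0 m U v ->
          enorm_pw m U tri (vnc \- J vnc) <= LambdaJ * enorm_pw m U tri (vnc \- v) &
        forall w, Pk m U tri w -> l2dot U (vnc \- J vnc) w = 0].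

Definition Lambda0 (R : realType) (m : nat) (U : set (plane R)) (n : nat)
    (tri : 'I_n -> 'I_3 -> plane R) (Vnc : set (plane R -> R))
    (J : (plane R -> R) -> plane R -> R) : R :=
  sup [set enorm_pw m U tri (v \- J v) / enorm_pw m U tri v
      | v in [set v | Vnc v /\ ~ aeeq U v (fun _ => 0)]].

Definition load (R : realType) (m : nat) (U : set (plane R)) (G : tfield R m)
    (g : plane R -> R) (A : {fset plane R}) (beta : plane R -> R)
    (v : plane R -> R) : R :=
  l2dotT U G (@wDm R m U v) + l2dot U g v + \sum_(a <- A) beta a * ptval U v a.

Definition apx (R : realType) (m : nat) (U : set (plane R)) (n : nat)
    (tri : 'I_n -> 'I_3 -> plane R) (kappa LambdaJ : R) (G : tfield R m)
    (g : plane R -> R) : R :=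
  (1 + LambdaJ) * osc0T U tri G
  + kappa * l2norm U (fun x => mesh tri x ^+ m * g x)
  + kappa * LambdaJ * osc m U tri g.

(* Main.v *)
Require Import Defs.
From HB Require Import structures.
From mathcomp Require Import all_boot all_order all_algebra finmap.
From mathcomp Require Import all_classical all_reals all_analysis.
From mathcomp Require Import measurable_realfun ring lra.

(** Write I for the interpolation, a for the piecewise energy product, |.| for its
    seminorm, and put e = u - J u_nc, z = I e. Interpolation errors are orthogonal to
    piecewise polynomials of degree m in the energy product, and v - J v is such an
    error (up to sign) for each discrete v because I (J v) = v. Hence
    |e|^2 = |e - z|^2 + |z|^2, and the continuous equation tested with e and the
    discrete one tested with z give

      |e|^2 = F (e - J z) + a (u_nc - J u_nc, e - z).

    The functional F is small on e - J z ([load_residual]). Its point values vanish,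
    because e and J z have the same interpolant z. Its derivatives of order m are
    orthogonal to piecewise constants, so only G - Pi_0 G acts. Finally
    e - J z = (e - z) + (z - J z), where the first part is bounded with weights by
    kappa |e - z|; the second part is bounded by kappa |z - J z| and, being orthogonal
    to piecewise polynomials in L^2, does not see Pi_m g. With
    |z - J z| <= Lambda_0 |z|, the Cauchy-Schwarz inequality in the plane of the pair
    (|e - z|, |z|) yields (a). For (b) one has |z - J z| <= Lambda_J |e - z|, so that
    F (e - J z) <= apx(F) |e - z|; expanding |u - u_nc|^2 and |e|^2 in terms of
    u - u_nc and u_nc - J u_nc, the mixed products cancel after an application of
    Young's inequality. Both arguments are carried out for an abstract semi-inner
    product in [error_a] and [error_b].

    What remains is to justify the calculus with weak derivatives used above. The
    product a is built from chosen weak derivatives, and it is bilinear only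
    because these are unique almost everywhere: this is [fundamental_lemma], which
    needs smooth functions of compact support that approximate the indicators of
    boxes. Polynomials and test functions have their classical derivatives as weak
    ones by [integration_by_parts_seq]. For functions in H^m of the whole domain the
    piecewise product equals the energy product, since weak derivatives restrict to
    open sets and the open triangles fill the domain up to a null set
    ([triangulation_pieces]). *)

Set Implicit Arguments.
Unset Strict Implicit.
Unset Printing Implicit Defensive.
Import Order.TTheory GRing.Theory Num.Theory.
Import numFieldNormedType.Exports.
Local Open Scope classical_set_scope.
Local Open Scope ring_scope.

(** * Borel sets and null sets of the plane *)

(** The product of the two Borel lines on which [leb2] is built. *)
Definition mplane (R : realType) : measurableType _ :=
  (measurableTypeR R * measurableTypeR R)%type.

Notation borel2 U := (@measurable _ (mplane _) U).

(** The set function [leb2] together with its structure of measure. *)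
Definition leb2_measure (R : realType) : {measure set (mplane R) -> \bar R} :=
  @lebesgue_integral_fubini_product_measure1__canonical__measure_function_Measure
     _ _ _ _ _ (@lebesgue_measure R) (@lebesgue_measure R).

Fact leb2_filter (R : realType) : Filter (almost_everywhere (@leb2 R)).
Proof. exact: (@ae_filter_ringOfSetsType _ (mplane R) R (leb2_measure R)). Qed.

#[local] Hint Extern 0 (Filter (nbhs (almost_everywhere _))) =>
  (exact: leb2_filter) : typeclass_instances.
#[local] Hint Extern 0 (Filter (almost_everywhere _)) =>
  (exact: leb2_filter) : typeclass_instances.

Section PlaneMeasure.
Variable R : realType.

Definition box (a b c d : R) : set (plane R) := `]a, b[%classic `*` `]c, d[%classic.

Lemma boxE a b c d x : box a b c d x <-> (a < x.1 < b) /\ (c < x.2 < d).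
Proof. by rewrite /box /= !in_itv/=. Qed.

Lemma measurable_box a b c d : borel2 (box a b c d).
Proof. by apply: measurableX; apply: measurable_itv. Qed.

Definition cbox (a b c d : R) : set (plane R) := `[a, b]%classic `*` `[c, d]%classic.

Lemma cboxE a b c d x : cbox a b c d x <-> (a <= x.1 <= b) /\ (c <= x.2 <= d).
Proof. by rewrite /cbox /= !in_itv/=. Qed.

Lemma box_cbox a b c d : box a b c d `<=` cbox a b c d.
Proof.
by move=> x /boxE[/andP[h1 h2] /andP[h3 h4]]; apply/cboxE; rewrite !ltW.
Qed.

Definition ratbox (q : (rat * rat) * (rat * rat)) : set (plane R) :=
  box (ratr q.1.1) (ratr q.1.2) (ratr q.2.1) (ratr q.2.2).

Definition ratcbox (q : (rat * rat) * (rat * rat)) : set (plane R) :=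
  cbox (ratr q.1.1) (ratr q.1.2) (ratr q.2.1) (ratr q.2.2).

Lemma ratbox_nbhs (U : set (plane R)) x : open U -> U x ->
  exists q, ratbox q x /\ ratcbox q `<=` U.
Proof.
move=> oU Ux.
have /nbhs_ballP[e /= e0 eU] : nbhs x U by apply: open_nbhs_nbhs.
have h (y : R) : exists a b : rat, [/\ y - e / 2 < ratr a, ratr a < y,
   y < ratr b & ratr b < y + e / 2].
  have [a] := @rat_in_itvoo R (y - e/2) y ltac:(rewrite ltrBlDr ltrDl divr_gt0//).
  have [b] := @rat_in_itvoo R y (y + e/2) ltac:(rewrite ltrDl divr_gt0//).
  rewrite !in_itv/= => /andP[yb by'] /andP[ya ay].
  by exists a, b.
have [a [b [ha hb hc hd]]] := h x.1.
have [a' [b' [ha' hb' hc' hd']]] := h x.2.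
exists ((a, b), (a', b')); split.
  by rewrite /ratbox boxE /= hb hc hb' hc'.
move=> y /cboxE[/andP[h1 h2] /andP[h3 h4]].
apply: eU; split; rewrite /ball /= ltr_norml; apply/andP; split; lra.
Qed.

(** The countable family of rational open boxes, restricted to those whose closed
    box stays inside U, so that test functions of U live on each of them. *)
Definition inner_box (U : set (plane R)) (k : nat) : set (plane R) :=
  if choice.unpickle k is Some q then
     (if `[< ratcbox q `<=` U >] then ratbox q else set0) else set0.

Lemma open_bigcup_box U : open U -> U = \bigcup_(k in [set: nat]) inner_box U k.
Proof.
move=> oU; apply/seteqP; split => [x Ux|x [k _]].
  have [q [qx qU]] := ratbox_nbhs oU Ux.
  exists (choice.pickle q); first exact: I.
  rewrite /inner_box choice.pickleK (asboolT qU); exact: qx.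
rewrite /inner_box; case: choice.unpickle => // q; case: asboolP => // qU /box_cbox.
exact: qU.
Qed.

Lemma open_borel2 (U : set (plane R)) : open U -> borel2 U.
Proof.
move=> /open_bigcup_box ->; apply: bigcupT_measurable => k.
rewrite /inner_box; case: choice.unpickle => [q|]; last exact: measurable0.
by case: asboolP => _; [exact: measurable_box|exact: measurable0].
Qed.

Lemma closed_borel2 (U : set (plane R)) : closed U -> borel2 U.
Proof. by move=> /closed_openC /open_borel2 /measurableC; rewrite setCK. Qed.

Lemma continuous_measurable_plane (f : plane R -> R) (U : set (mplane R)) :
  continuous f -> @measurable_fun _ _ (mplane R) R U f.
Proof.
move=> cf; apply: measurable_funTS.
apply: (measurability _ (RGenOpens.measurableE R)).
move=> _ [_ [a [b ->] <-]]; rewrite setTI; apply: open_borel2.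
move/continuousP : cf; apply; exact: interval_open.
Qed.

Definition null (N : set (plane R)) := (@leb2 R).-negligible N.

Lemma nullS (A B : set (plane R)) : B `<=` A -> null A -> null B.
Proof. exact: (@negligibleS _ (mplane R) R (leb2_measure R)). Qed.

Lemma null0 : null set0.
Proof. by exists set0; split => //; rewrite measure0. Qed.

Lemma null_bigcup (F : (set (plane R))^nat) : (forall k, null (F k)) ->
  null (\bigcup_(k in [set: nat]) F k).
Proof. exact: (@negligible_bigcup _ (mplane R) R (leb2_measure R)). Qed.

Lemma nullU A B : null A -> null B -> null (A `|` B).
Proof. exact: (@negligibleU _ (mplane R) R (leb2_measure R)). Qed.

Lemma null_bigcup_ord n (F : 'I_n -> set (plane R)) : (forall k, null (F k)) ->
  null (\bigcup_(i in [set: 'I_n]) F i).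
Proof.
move=> h; have := @null_bigcup (fun k => if insub k is Some i then F i else set0).
have h' k : null (if insub k is Some i then F i else set0).
  by case: insubP => [i _ _|_] //; exact: null0.
move=> /(_ h'); apply: nullS => x [i _ Fx].
exists (i : nat); first exact: I.
by rewrite valK.
Qed.

Lemma aeP (P : plane R -> Prop) : {ae @leb2 R, forall x, P x} <-> null (~` P).
Proof. by []. Qed.

Lemma aeeqP U f g : aeeq U f g <-> null [set x | U x /\ f x <> g x].
Proof.
rewrite /aeeq aeP; split; apply: nullS => x /=; first by move=> [Ux fg] h; exact/fg/h.
by move=> /not_implyP.
Qed.

Lemma box_measure_gt0 a b c d : a < b -> c < d -> (0 < @leb2 R (box a b c d))%E.
Proof.
move=> ab cd; rewrite /leb2 /box.
rewrite product_measure1E; [|exact: measurable_itv..].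
have h (s t : R) : s < t -> lebesgue_measure (`]s, t[%classic : set R) = (t - s)%:E.
  by move=> st; rewrite lebesgue_measure_itv/= lte_fin st EFinB.
rewrite [X in (X * _)%E](h _ _ ab) [X in (_ * X)%E](h _ _ cd).
by rewrite mule_gt0// lte_fin subr_gt0.
Qed.

Lemma open_not_null (U : set (plane R)) x : open U -> U x -> ~ null U.
Proof.
move=> oU Ux [N [mN N0 UN]].
have [q [qx qU]] := ratbox_nbhs oU Ux.
have /boxE[/andP[h1 h2] /andP[h3 h4]] := qx.
have := box_measure_gt0 (lt_trans h1 h2) (lt_trans h3 h4).
apply/negP; rewrite -leNgt -N0; apply: le_measure; rewrite ?inE//.
  exact: measurable_box.
exact: subset_trans (subset_trans (@box_cbox _ _ _ _) qU) UN.
Qed.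

(** Two representatives that are continuous at a and differ there differ on a
    whole neighbourhood of a, and a nonempty open set is not null. *)
Lemma ptval_unique (U : set (plane R)) v w a c c' : open U -> U a ->
  aeeq U v w -> has_ptval U v a c -> has_ptval U w a c' -> c = c'.
Proof.
move=> oU Ua vw [f [vf cf <-]] [g [wg cg <-]].
apply: contrapT => /eqP fga.
pose h := f \- g.
have ch : {for a, continuous h} by apply: continuousB.
have : nbhs a [set x | h x != 0].
  have : nbhs (h a) [set y : R | y != 0].
    apply: open_nbhs_nbhs; split; first exact: open_neq.
    by rewrite /= /h /= subr_eq0.
  exact: ch.
move=> h0; have : nbhs a (U `&` [set x | h x != 0]).
  by apply: filterI => //; apply: open_nbhs_nbhs.
rewrite nbhsE => -[V [oV Va] VU]; apply: (open_not_null oV Va).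
have : aeeq U f g.
  move: vf wg vw; rewrite /aeeq; apply: filterS3 => x h1 h2 h3 Ux.
  by rewrite -h1// -h2// h3.
move=> /aeeqP; apply: nullS => x /VU[Ux hx]; split => // fg.
by move: hx; rewrite /= /h /= fg subrr eqxx.
Qed.

(** By Fubini: if be <> 0 every vertical slice is one point; otherwise the line is
    the product of a point with the real line. *)
Lemma null_line (al be ga : R) : (al != 0) || (be != 0) ->
  null [set x : plane R | al * x.1 + be * x.2 = ga].
Proof.
move=> hab; exists [set x : plane R | al * x.1 + be * x.2 = ga]; split => //.
  apply: closed_borel2.
  have cf : continuous (fun x : plane R => al * x.1 + be * x.2).
    move=> x; apply: (@cvgD _ _ _ (nbhs x)); apply: cvgM; try exact: cvg_cst.
      exact: cvg_fst.
    exact: cvg_snd.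
  apply: (@closed_comp _ _ (fun x : plane R => al * x.1 + be * x.2) [set ga]) => //.
have sing (S : set R) (c : R) : S `<=` [set c] -> lebesgue_measure S = 0%E.
  move=> /subset_set1[] ->; [exact: measure0|exact: lebesgue_measure_set1].
have [be0|be0] := eqVneq be 0; last first.
  rewrite /leb2 /product_measure1.
  apply: integral0_eq => x _; apply: (sing _ ((ga - al * x) / be)) => y.
  rewrite /xsection /= inE /= => <-; field.
  exact: be0.
move: hab; rewrite be0 eqxx orbF => al0.
rewrite (_ : [set x | _] = [set ga / al] `*` setT); last first.
  apply/seteqP; split => x /=.
    by rewrite mul0r addr0 => <-; split => //; field.
  by move=> [-> _]; rewrite mul0r addr0; field.
rewrite /leb2 product_measure1E//.
by rewrite [X in (X * _)%E]lebesgue_measure_set1 mul0e.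
Qed.

End PlaneMeasure.

(** * The space L^2 of a Borel set *)

(** Restricting to a smaller set is immediate for the two conditions on the right,
    whereas membership in [Lfun] speaks of the function extended by 0. *)
Lemma Lfun2P d (T : measurableType d) (R : realType)
    (m : {measure set T -> \bar R}) (U : set T) (f : T -> R) : measurable U ->
  (f \_ U : T -> R) \in Lfun m 2%:E <->
  measurable_fun U f /\ m.-integrable U (fun x => (f x ^+ 2)%:E).
Proof.
move=> mU.
have sqrU : (fun x => (((f \_ U) x) ^+ 2)%:E) = ((fun x => (f x ^+ 2)%:E) \_ U)%E :> (T -> \bar R).
  by apply/funext => x; rewrite !patchE; case: ifP => // _; rewrite expr0n.
split=> [h|[mf sf]].
  split; last first.
    apply/(integrable_mkcond _ mU); rewrite -sqrU.
    exact: Lfun2_integrable_sqr h.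
  apply/(measurable_restrictT _ mU).
  by move: h; rewrite inE => /andP[/[!inE]].
have mfU : measurable_fun setT (f \_ U) by apply/(measurable_restrictT _ mU).
rewrite inE; apply/andP; split; first by rewrite inE.
rewrite inE /= /finite_norm unlock /Lnorm poweR_lty//.
move/(integrable_mkcond _ mU) : sf; rewrite -sqrU => /integrableP[_].
apply: le_lt_trans; rewrite le_eqVlt; apply/orP; left; apply/eqP.
apply: eq_integral => x _ /=.
by rewrite powR_mulrn// normrX.
Qed.

Lemma Lfun2_mul_integrable d (T : measurableType d) (R : realType)
    (m : {measure set T -> \bar R}) (U : set T) (f g : T -> R) : measurable U ->
  (f \_ U : T -> R) \in Lfun m 2%:E -> (g \_ U : T -> R) \in Lfun m 2%:E ->
  m.-integrable U (fun x => (f x * g x)%:E).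
Proof.
move=> mU fU gU; apply/(integrable_mkcond _ mU).
have /Lfun1_integrable := Lfun2_mul_Lfun1 fU gU.
congr (_.-integrable _ _); apply/funext => x /=.
by rewrite !patchE; case: ifP => // _; rewrite mulr0.
Qed.

Section PlaneL2.
Variable R : realType.
Implicit Types (U V : set (plane R)) (f g h : plane R -> R).
Notation mu := (@leb2 R).

Lemma L2P U f : borel2 U ->
  L2 U f <-> @measurable_fun _ _ (mplane R) R U f /\ mu.-integrable U (fun x => (f x ^+ 2)%:E).
Proof. exact: (@Lfun2P _ (mplane R) R (leb2_measure R)). Qed.

Lemma L2_measurable U f : borel2 U -> L2 U f -> @measurable_fun _ _ (mplane R) R U f.
Proof. by move=> mU /(L2P _ mU)[]. Qed.

Lemma L2_mul U f g : borel2 U -> L2 U f -> L2 U g ->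
  mu.-integrable U (fun x => (f x * g x)%:E).
Proof. exact: (@Lfun2_mul_integrable _ (mplane R) R (leb2_measure R)). Qed.

Lemma eq_Lfun2 (F F' : mplane R -> R) : F =1 F' -> F \in Lfun (leb2_measure R) 2%:E ->
  F' \in Lfun (leb2_measure R) 2%:E.
Proof. by move=> /funext ->. Qed.

Let le12 : (1 <= 2%:E :> \bar R)%E. Proof. by rewrite lee_fin; lra. Qed.

Lemma L2_lin U (c : R) f g : L2 U f -> L2 U g ->
  L2 U (fun x => c * f x + g x).
Proof.
move=> Lf Lg.
have := (Lfun_submod_closed (leb2_measure R) le12).2 c (f \_ U) (g \_ U) Lf Lg.
apply: eq_Lfun2 => x.
rewrite !fctE /= !patchE; case: ifP => // _.
by rewrite [c *: _]mulr0 addr0.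
Qed.

Lemma L2_eq U f g : (forall x, U x -> f x = g x) -> L2 U f -> L2 U g.
Proof.
move=> fg; apply: eq_Lfun2 => x.
by rewrite !patchE; case: ifP => //; rewrite inE; exact: fg.
Qed.

Lemma L2_0 U : L2 U (fun=> 0).
Proof.
have := (Lfun_submod_closed (leb2_measure R) le12).1.
apply: eq_Lfun2 => x.
by rewrite !patchE; case: ifP.
Qed.

Lemma L2Z U c f : L2 U f -> L2 U (fun x => c * f x).
Proof.
by move=> Lf; have := L2_lin c Lf (L2_0 U); apply: L2_eq => x _; rewrite addr0.
Qed.

Lemma L2D U f g : L2 U f -> L2 U g -> L2 U (fun x => f x + g x).
Proof. by move=> Lf Lg; have := L2_lin 1 Lf Lg; apply: L2_eq => x _; rewrite mul1r. Qed.

Lemma L2B U f g : L2 U f -> L2 U g -> L2 U (f \- g).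
Proof.
by move=> Lf Lg; have := L2_lin (-1) Lg Lf; apply: L2_eq => x _; rewrite /= mulN1r addrC.
Qed.

Lemma L2_sum U (I : Type) (r : seq I) (F : I -> plane R -> R) :
  (forall i, L2 U (F i)) -> L2 U (fun x => \sum_(i <- r) F i x).
Proof.
move=> LF; elim: r => [|i r IH].
  by apply: L2_eq (L2_0 U) => x _; rewrite big_nil.
by apply: L2_eq (L2D (LF i) IH) => x _; rewrite big_cons.
Qed.

Lemma L2_sub U V f : borel2 U -> borel2 V -> V `<=` U -> L2 U f -> L2 V f.
Proof.
move=> mU mV VU /(L2P _ mU)[mf i]; apply/(L2P _ mV); split.
  exact: measurable_funS mf.
exact: integrableS i.
Qed.

Lemma L2_patch U V f : borel2 U -> borel2 V -> L2 V f -> V `<=` U -> L2 U (f \_ V).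
Proof.
move=> mU mV + VU; apply: eq_Lfun2 => x.
rewrite !patchE; have [Vx|Vx] := pselect (V x).
  by rewrite (mem_set Vx) (mem_set (VU _ Vx)).
by rewrite (memNset Vx); case: ifP.
Qed.

Lemma l2dotC U f g : l2dot U f g = l2dot U g f.
Proof. by rewrite /l2dot; congr fine; apply: eq_integral => x _; rewrite mulrC. Qed.

Lemma eq_l2dot U f f' g g' : (forall x, U x -> f x = f' x) ->
  (forall x, U x -> g x = g' x) -> l2dot U f g = l2dot U f' g'.
Proof.
move=> ff gg; rewrite /l2dot; congr fine; apply: eq_integral => x.
by rewrite inE => Ux; rewrite ff// gg.
Qed.

Lemma l2dot_linl U (c : R) f g h : borel2 U -> L2 U f -> L2 U g -> L2 U h ->
  l2dot U (fun x => c * f x + g x) h = c * l2dot U f h + l2dot U g h.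
Proof.
move=> mU Lf Lg Lh; rewrite /l2dot.
have If := L2_mul mU Lf Lh; have Ig := L2_mul mU Lg Lh.
rewrite -(@RintegralZl _ (mplane R) R (leb2_measure R))//.
rewrite -(@RintegralD _ (mplane R) R (leb2_measure R))//; last first.
  have := L2_mul mU (L2Z c Lf) Lh; congr (_.-integrable _ _).
  by apply/funext => x /=; rewrite mulrA.
by congr fine; apply: eq_integral => x _; rewrite mulrDl mulrA.
Qed.

Lemma l2dot_linr U (c : R) f g h : borel2 U -> L2 U f -> L2 U g -> L2 U h ->
  l2dot U h (fun x => c * f x + g x) = c * l2dot U h f + l2dot U h g.
Proof. by move=> *; rewrite l2dotC l2dot_linl// ![l2dot U h _]l2dotC. Qed.

Lemma l2dotBl U f g h : borel2 U -> L2 U f -> L2 U g -> L2 U h ->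
  l2dot U (f \- g) h = l2dot U f h - l2dot U g h.
Proof.
move=> mU Lf Lg Lh; rewrite [RHS]addrC -[- _]mulN1r -l2dot_linl//.
by apply: eq_l2dot => // x _; rewrite mulN1r addrC.
Qed.

Lemma l2dotBr U f g h : borel2 U -> L2 U f -> L2 U g -> L2 U h ->
  l2dot U h (f \- g) = l2dot U h f - l2dot U h g.
Proof. by move=> *; rewrite l2dotC l2dotBl// ![l2dot U h _]l2dotC. Qed.

Lemma l2dot_ge0 U f : 0 <= l2dot U f f.
Proof. by apply: Rintegral_ge0 => x _; rewrite -expr2 sqr_ge0. Qed.

Lemma l2dot0l U g : l2dot U (fun=> 0) g = 0.
Proof.
rewrite /l2dot /Rintegral integral0_eq// => x _; by rewrite mul0r.
Qed.

Lemma l2dot_ae U f f' g g' : borel2 U -> L2 U f -> L2 U f' -> L2 U g -> L2 U g' ->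
  aeeq U f f' -> aeeq U g g' -> l2dot U f g = l2dot U f' g'.
Proof.
move=> mU Lf Lf' Lg Lg' ff gg.
rewrite /l2dot /Rintegral; congr fine.
apply: (@ae_eq_integral _ (mplane R) R (leb2_measure R)) => //.
- apply/measurable_EFinP; apply: measurable_funM; exact: L2_measurable.
- apply/measurable_EFinP; apply: measurable_funM; exact: L2_measurable.
- by move: ff gg; rewrite /aeeq; apply: filterS2 => x fx gx Ux; rewrite /= fx// gx.
Qed.

Lemma l2dot_restrict U V f g : V `<=` U -> (forall x, U x -> ~ V x -> f x * g x = 0) ->
  l2dot V f g = l2dot U f g.
Proof.
move=> VU fg0; rewrite /l2dot /Rintegral; congr fine.
rewrite integral_mkcond [RHS]integral_mkcond; apply: eq_integral => x _.
rewrite !patchE; have [Vx|Vx] := pselect (V x).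
  by rewrite (mem_set Vx) (mem_set (VU _ Vx)).
by rewrite (memNset Vx); case: ifP => //; rewrite inE => Ux; rewrite fg0.
Qed.

End PlaneL2.

(** * Smooth functions *)

Section Smooth.
Variable R : realType.
Implicit Types (f g : plane R -> R) (s : seq 'I_2) (j : 'I_2).

(** Smoothness of finite order, the induction variable for the closure
    properties of smooth functions. *)
Definition nsmooth (n : nat) f :=
  forall s x, (size s <= n)%N -> differentiable (pder s f) x.

Lemma pder_rcons s j f : pder (rcons s j) f = pder s ('D_(e2 R j) f).
Proof. by rewrite /pder foldr_rcons. Qed.

Lemma smoothP f : smooth f <-> forall n, nsmooth n f.
Proof.
by split=> [h n s x _|h s x]; [exact: h|exact: (h (size s))].
Qed.

Lemma nsmoothS n f : (forall x, differentiable f x) ->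
  (forall j, nsmooth n ('D_(e2 R j) f)) -> nsmooth n.+1 f.
Proof.
move=> df Df s; case/lastP: s => [|s j] x; first by move=> _; exact: df.
rewrite size_rcons ltnS pder_rcons => sn; exact: Df.
Qed.

Lemma nsmooth_diff n f x : nsmooth n f -> differentiable f x.
Proof. by move=> /(_ [::] x); apply. Qed.

Lemma nsmooth_derive n f j : nsmooth n.+1 f -> nsmooth n ('D_(e2 R j) f).
Proof.
move=> h s x sn; rewrite -pder_rcons; apply: h.
by rewrite size_rcons ltnS.
Qed.

Lemma nsmoothW n f : nsmooth n.+1 f -> nsmooth n f.
Proof. by move=> h s x sn; apply: h; exact: leqW. Qed.

Lemma smooth_derive f j : smooth f -> smooth ('D_(e2 R j) f).
Proof. by move=> h s x; rewrite -pder_rcons. Qed.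

Lemma smooth_diff f x : smooth f -> differentiable f x.
Proof. by move/(_ [::] x). Qed.

Lemma smooth_continuous f : smooth f -> continuous f.
Proof. by move=> sf x; apply: differentiable_continuous; exact: smooth_diff. Qed.

Lemma smooth_pder s f : smooth f -> smooth (pder s f).
Proof. by elim: s => //= j s IH /IH sf; exact: smooth_derive. Qed.

Lemma smooth_cst c : smooth (fun=> c : R).
Proof.
have h n : forall c : R, nsmooth n (fun=> c).
  elim: n => [|n IH] {}c; first by move=> [|//] x _; exact: differentiable_cst.
  apply: nsmoothS => [x|j]; first exact: differentiable_cst.
  rewrite (_ : 'D_(e2 R j) _ = fun=> 0)//.
  by apply/funext => x; rewrite derive_cst.
by apply/smoothP => n; exact: h.
Qed.

Lemma nsmoothD n f g : nsmooth n f -> nsmooth n g -> nsmooth n (fun x => f x + g x).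
Proof.
elim: n f g => [|n IH] f g sf sg.
  move=> [|//] x _; apply: differentiableD; [exact: nsmooth_diff sf|exact: nsmooth_diff sg].
apply: nsmoothS => [x|j].
  by apply: differentiableD; [exact: nsmooth_diff sf|exact: nsmooth_diff sg].
rewrite (_ : 'D_(e2 R j) _ = fun x => 'D_(e2 R j) f x + 'D_(e2 R j) g x); last first.
  apply/funext => x; rewrite deriveD//; apply: diff_derivable.
    exact: nsmooth_diff sf.
  exact: nsmooth_diff sg.
by apply: IH; exact: nsmooth_derive.
Qed.

Lemma smoothD f g : smooth f -> smooth g -> smooth (fun x => f x + g x).
Proof.
by move=> /smoothP sf /smoothP sg; apply/smoothP => n; apply: nsmoothD.
Qed.

Lemma deriveM_fun f g j : (forall x, differentiable f x) -> (forall x, differentiable g x) ->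
  'D_(e2 R j) (fun x => f x * g x) = fun x => f x * 'D_(e2 R j) g x + 'D_(e2 R j) f x * g x.
Proof.
move=> df dg; apply/funext => x.
rewrite deriveM; try exact: diff_derivable.
by rewrite /= [g x *: _]mulrC.
Qed.

Lemma nsmoothM n f g : nsmooth n f -> nsmooth n g -> nsmooth n (fun x => f x * g x).
Proof.
elim: n f g => [|n IH] f g sf sg.
  move=> [|//] x _; apply: differentiableM; [exact: nsmooth_diff sf|exact: nsmooth_diff sg].
have df x := nsmooth_diff x sf; have dg x := nsmooth_diff x sg.
apply: nsmoothS => [x|j]; first exact: differentiableM.
rewrite deriveM_fun//; apply: nsmoothD; apply: IH.
- exact: nsmoothW.
- exact: nsmooth_derive.
- exact: nsmooth_derive.
- exact: nsmoothW.
Qed.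

Lemma smoothM f g : smooth f -> smooth g -> smooth (fun x => f x * g x).
Proof.
by move=> /smoothP sf /smoothP sg; apply/smoothP => n; apply: nsmoothM.
Qed.

Lemma smoothX f k : smooth f -> smooth (fun x => f x ^+ k).
Proof.
move=> sf; elim: k => [|k IH].
  have := smooth_cst 1; congr smooth.
have := smoothM sf IH; congr smooth; apply/funext => x; rewrite exprS//.
Qed.

Lemma smooth_sum (I : Type) (r : seq I) (P : pred I) (F : I -> plane R -> R) :
  (forall i, smooth (F i)) -> smooth (fun x => \sum_(i <- r | P i) F i x).
Proof.
move=> sF; elim: r => [|i r IH].
  have := smooth_cst 0; congr smooth; apply/funext => x; by rewrite big_nil.
have [Pi|Pi] := boolP (P i).
  have := smoothD (sF i) IH; congr smooth; apply/funext => x.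
  by rewrite big_cons Pi.
by have := IH; congr smooth; apply/funext => x; rewrite big_cons (negbTE Pi).
Qed.

Lemma smooth_of_cst_derive f : (forall x, differentiable f x) ->
  (forall j, exists c, 'D_(e2 R j) f = fun=> c) -> smooth f.
Proof.
move=> df Df; apply/smoothP => -[|n]; first by move=> [|//] x _; exact: df.
apply: nsmoothS => // j; have [c ->] := Df j.
exact: ((smoothP _).1 (smooth_cst c)).
Qed.

Lemma derive_linear_cst f j : linear f -> continuous f ->
  (forall x, differentiable f x) /\ 'D_(e2 R j) f = fun=> f (e2 R j).
Proof.
move=> lf cf.
pose F := HB.pack f (GRing.isLinear.Build R (R * R)%type R _ f lf) : {linear (R * R)%type -> R}.
have dF x : differentiable F x by apply: linear_differentiable.
split => //; apply/funext => x.
by rewrite deriveE// (@diff_lin _ _ _ F).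
Qed.

Lemma smooth_fst : smooth (fun x : plane R => x.1).
Proof.
have h j := @derive_linear_cst (fun x : plane R => x.1) j
  ltac:(by []) ltac:(by move=> x; exact: cvg_fst).
apply: smooth_of_cst_derive; first exact: (h ord0).1.
by move=> j; exists (e2 R j).1; exact: (h j).2.
Qed.

Lemma smooth_snd : smooth (fun x : plane R => x.2).
Proof.
have h j := @derive_linear_cst (fun x : plane R => x.2) j
  ltac:(by []) ltac:(by move=> x; exact: cvg_snd).
apply: smooth_of_cst_derive; first exact: (h ord0).1.
by move=> j; exists (e2 R j).2; exact: (h j).2.
Qed.

Lemma smooth_poly2 k c : smooth (@poly2 R k c).
Proof.
apply: smooth_sum => i; apply: smooth_sum => j.
apply: smoothM; last exact: smoothX smooth_snd.
apply: smoothM; last exact: smoothX smooth_fst.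
exact: smooth_cst.
Qed.

(** The chain rule produces F' composed with f, times a derivative of f. If F' stays
    in the family C, the same argument applies to it at the next order. *)
Lemma smooth_comp (C : set (R -> R)) (f : plane R -> R) :
  (forall F, C F -> exists2 F', C F' & forall t : R, is_derive t (1 : R) F (F' t)) ->
  smooth f -> forall F, C F -> smooth (F \o f).
Proof.
move=> hC sf F CF; apply/smoothP => n.
elim: n F CF => [|n IH] F CF.
  have [F' CF' dF] := hC F CF.
  move=> [|//] x _; apply: differentiable_comp; first exact: smooth_diff.
  by apply/derivable1_diffP; have [] := dF (f x).
have [F' CF' dF] := hC F CF.
have diffF t : differentiable F t by apply/derivable1_diffP; have [] := dF t.
apply: nsmoothS => [x|j].
  by apply: differentiable_comp => //; exact: smooth_diff.
rewrite (_ : 'D_(e2 R j) _ = fun x => 'D_(e2 R j) f x * (F' \o f) x).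
  by apply: nsmoothM; [exact: ((smoothP _).1 (smooth_derive j sf))|exact: IH].
apply/funext => x.
rewrite deriveE; last by apply: differentiable_comp => //; exact: smooth_diff.
rewrite diff_comp//; last exact: smooth_diff.
rewrite /= diff1E//= derive1E; have [_ ->] := dF (f x).
by rewrite -deriveE//; exact: smooth_diff.
Qed.

(** The functions p(1/t) exp(-1/t), extended by 0 to t <= 0. They form the family
    generated by exp(-1/t) under differentiation. *)
Definition flat (p : {poly R}) (t : R) : R :=
  if 0 < t then p.[t^-1] * expR (- t^-1) else 0.

(** Term by term, since s^i <= i! exp s. *)
Lemma poly_exp_bound (p : {poly R}) :
  exists K : R, forall s : R, 0 <= s -> `|p.[s]| <= K * expR s.
Proof.
exists (\sum_(i < size p) `|p`_i| * (i`!)%:R) => s s0.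
rewrite horner_coef (le_trans (ler_norm_sum _ _ _))// mulr_suml.
apply: ler_sum => i _; rewrite normrM -mulrA ler_wpM2l//.
rewrite ger0_norm ?exprn_ge0//.
case: i => -[|i] /= _; first by rewrite expr0 fact0 mul1r -expR0 ler_expR.
have := expR_ge1Dxn i s0.
have : s ^+ i.+1 / i.+1`!%:R <= 1 + s ^+ i.+1 / i.+1`!%:R by rewrite lerDr.
move=> /le_trans/[apply]; rewrite ler_pdivrMr; last by rewrite ltr0n fact_gt0.
by rewrite mulrC.
Qed.

(** The bound of [poly_exp_bound] for p(s) s^2 at s = 1/t. A bound of order t^2 is
    what differentiability at 0, with derivative 0, requires. *)
Lemma flat_quadratic_bound (p : {poly R}) : exists K, forall t, `|flat p t| <= K * t ^+ 2.
Proof.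
have [K hK] := poly_exp_bound (p * 'X^2).
exists K => t; rewrite /flat.
have K0 : 0 <= K.
  have := hK 0 (lexx _); rewrite expR0 mulr1; exact: le_trans (normr_ge0 _).
case: ifPn => [t0|_]; last by rewrite normr0 mulr_ge0// sqr_ge0.
have := hK t^-1; rewrite invr_ge0 => /(_ (ltW t0)).
rewrite hornerM hornerXn normrM [ `|_ ^+ _| ]ger0_norm ?exprn_ge0 ?invr_ge0 ?(ltW t0)//.
rewrite normrM [ `|expR _| ]ger0_norm ?expR_ge0// expRN => h.
rewrite ler_pdivrMr ?expR_gt0//.
have := ler_wpM2r (sqr_ge0 t) h.
rewrite -mulrA -exprMn mulVf ?gt_eqF// expr1n mulr1 => /le_trans; apply.
by rewrite mulrAC.
Qed.

Lemma is_derive_val_eq (f : R -> R) (x a b : R) :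
  is_derive x (1 : R) f a -> a = b -> is_derive x (1 : R) f b.
Proof. by move=> + <-. Qed.

(** The rule is (d/dt) p(1/t) exp(-1/t) = t^-2 (p - p')(1/t) exp(-1/t); at t = 0 it
    follows from [flat_quadratic_bound]. *)
Lemma flat_derive (p : {poly R}) t :
  is_derive t (1 : R) (flat p) (flat ('X^2 * (p - p^`())) t).
Proof.
have [t0|t0|t0] := ltrgt0P t.
- have E : {near t, flat p =1 fun s : R => p.[s^-1] * expR (- s^-1)}.
    have : \forall x \near t, 0 < x by exact: lt_nbhsr.
    by apply: filterS => s s0; rewrite /flat s0.
  apply: (near_eq_is_derive (f := fun s : R => p.[s^-1] * expR (- s^-1))).
  + by apply: filterS E => s ->.
  have tn0 : t != 0 by rewrite gt_eqF.
  have dV : is_derive t (1 : R) (fun s : R => s^-1) (- (t ^- 2)).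
    apply: (is_derive_val_eq (is_deriveV tn0 (is_derive_id t (1 : R)))).
    by rewrite /= [_ *: 1]mulr1.
  have dN : is_derive t (1 : R) (fun s : R => - s^-1) (t ^- 2).
    by apply: (is_derive_val_eq (is_deriveN dV)); rewrite opprK.
  have dp : is_derive t (1 : R) (fun s : R => p.[s^-1]) (p^`().[t^-1] * - (t ^- 2)).
    have dh : is_derive (t^-1) (1 : R) (horner p) p^`().[t^-1].
      apply: DeriveDef; first exact: derivable_horner.
      by rewrite -derive1E -derivE.
    exact: (is_derive1_comp dh dV).
  have de : is_derive t (1 : R) (fun s : R => expR (- s^-1)) (expR (- t^-1) * t ^- 2).
    apply: (is_derive_val_eq (@is_derive1_comp _ expR (fun s : R => - s^-1) t _ _ (is_derive_expR (- t^-1)) dN)); first by [].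
 
  apply: (is_derive_val_eq (is_deriveM dp de)).
  rewrite /flat t0 !hornerE /= -exprVn /GRing.scale /=. match goal with |- ?g => idtac g end. ring.
- have E : {near t, flat p =1 cst 0}.
    have : \forall x \near t, x < 0 by exact: lt_nbhsl.
    by apply: filterS => s s0; rewrite /flat ltNge (ltW s0).
  apply: (near_eq_is_derive (f := cst 0)).
  + by apply: filterS E => s ->.
  by rewrite /flat ltNge (ltW t0) /=; exact: is_derive_cst.
- rewrite t0.
  have -> : flat ('X^2 * (p - p^`())) 0 = 0 by rewrite /flat ltxx.
  have [K hK] := flat_quadratic_bound p.
  have H : (h^-1 *: ((flat p \o shift (0 : R)) (h *: (1 : R)) - flat p 0)) @[h --> (0 : R)^'] --> (0 : R).
    apply/cvgrPdist_le => e e0.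
    have K1 : 0 < `|K| + 1 by rewrite ltr_wpDl.
    near=> h.
    have h0 : h != 0 by near: h; exact: nbhs_dnbhs_neq.
    rewrite sub0r normrN /= addr0 {2}/flat ltxx subr0 normrM normfV.
    rewrite ler_pdivrMl ?normr_gt0// [h *: 1]mulr1.
    apply: (le_trans (hK h)); rewrite -real_normK ?num_real// expr2 mulrA mulrC.
    rewrite ler_wpM2l// (@le_trans _ _ ((`|K| + 1) * `|h|))//.
      by rewrite ler_wpM2r// (le_trans (ler_norm K))// lerDl.
    rewrite -ler_pdivlMl//.
    near: h; apply: dnbhs0_le; rewrite mulr_gt0// invr_gt0//.
  apply: DeriveDef; first by apply: cvgP H.
  by rewrite /derive; apply: cvg_lim.
Unshelve. all: by end_near. Qed.

End Smooth.

(** * Continuous functions on bounded sets *)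

Section Bounded.
Variable R : realType.
Implicit Types (U V : set (plane R)) (f : plane R -> R).
Notation mu := (@leb2 R).

Lemma compact_cbox (a b c d : R) : compact (cbox a b c d : set (plane R)).
Proof. by apply: compact_setX; apply: segment_compact. Qed.

Lemma bounded_cboxP V : bounded_set V ->
  exists2 N : R, 0 < N & V `<=` cbox (- N) N (- N) N.
Proof.
move=> [M [_ hM]]; exists (`|M| + 1); first by rewrite ltr_wpDl.
move=> x Vx; have : `|x| <= `|M| + 1.
  by apply: (hM (`|M| + 1)) => //; rewrite (le_lt_trans (ler_norm M))// ltrDl.
rewrite prod_normE ge_max => /andP[h1 h2]; apply/cboxE.
by rewrite -!ler_norml.
Qed.

Lemma bounded_set_cbox (a b c d : R) : bounded_set (cbox a b c d).
Proof. exact: compact_bounded (@compact_cbox a b c d). Qed.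

Lemma bounded_setS U V : V `<=` U -> bounded_set U -> bounded_set V.
Proof.
by move=> VU [M [Mr hM]]; exists M; split => // N MN x /VU Ux; exact: (hM N).
Qed.

Lemma bounded_measure_lty V : borel2 V -> bounded_set V -> (mu V < +oo)%E.
Proof.
move=> mV /bounded_cboxP[N N0 VN].
have mc : borel2 (cbox (- N) N (- N) N) by apply: measurableX; exact: measurable_itv.
apply: (@le_lt_trans _ _ (mu (cbox (- N) N (- N) N))).
  by apply: (@le_measure _ _ _ (leb2_measure R)) => //; rewrite inE.
rewrite /leb2 product_measure1E; [|exact: measurable_itv..].
have h : lebesgue_measure (`[- N, N]%classic : set R) = (N - - N)%:E.
  have NN : - N < N by lra.
  by rewrite lebesgue_measure_itv/= lte_fin NN EFinB.
by rewrite [X in (X * _)%E]h [X in (_ * X)%E]h -EFinM ltry.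
Qed.

Lemma continuous_bounded_on V f : continuous f -> bounded_set V ->
  exists M : R, forall x, V x -> `|f x| <= M.
Proof.
move=> cf /bounded_cboxP[N N0 VN].
have : compact (f @` cbox (- N) N (- N) N).
  apply: continuous_compact; last exact: compact_cbox.
  exact: continuous_subspaceT.
move=> /compact_bounded[M [_ hM]]; exists (`|M| + 1) => x /VN Vx.
apply: (hM (`|M| + 1)); last by exists x.
by rewrite (le_lt_trans (ler_norm M))// ltrDl.
Qed.

Lemma integrable_continuous V f : borel2 V -> bounded_set V -> continuous f ->
  mu.-integrable V (EFin \o f).
Proof.
move=> mV bV cf.
apply: (@measurable_bounded_integrable _ (mplane R) R (leb2_measure R)) => //.
- exact: bounded_measure_lty.
- exact: continuous_measurable_plane.
have [M hM] := continuous_bounded_on cf bV.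
by exists M; split; [exact: num_real|move=> K MK x Vx; apply: (le_trans (hM x Vx)); exact: ltW].
Qed.

Lemma L2_continuous V f : borel2 V -> bounded_set V -> continuous f -> L2 V f.
Proof.
move=> mV bV cf; apply/(L2P _ mV); split; first exact: continuous_measurable_plane.
apply: (integrable_continuous mV bV (f := fun x => f x ^+ 2)).
by move=> x; under eq_fun do rewrite expr2; apply: cvgM; exact: cf.
Qed.

Lemma L2_integrable V f : borel2 V -> bounded_set V -> L2 V f ->
  mu.-integrable V (EFin \o f).
Proof.
move=> mV bV Lf.
have L1 : L2 V (fun=> 1) by apply: L2_continuous => // x; exact: cst_continuous.
have := L2_mul mV Lf L1; congr (is_true (_.-integrable _ _)).
by apply/funext => x /=; rewrite mulr1.
Qed.

End Bounded.

(** * Test functions *)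

Section TestFunctions.
Variable R : realType.
Implicit Types (U V K : set (plane R)) (f phi psi : plane R -> R).

Lemma derive_outside K f j : closed K -> (forall x, ~ K x -> f x = 0) ->
  forall x, ~ K x -> 'D_(e2 R j) f x = 0.
Proof.
move=> cK f0 x Kx.
rewrite -(near_eq_derive (f := cst 0) (g := f)) ?derive_cst//.
have : nbhs x (~` K) by apply: open_nbhs_nbhs; split => //; exact: closed_openC.
by apply: filterS => y Ky; rewrite f0.
Qed.

Lemma hausdorff_plane : hausdorff_space (R * R)%type.
Proof. exact: norm_hausdorff. Qed.

Lemma test_fun_derive U phi j : test_fun U phi -> test_fun U ('D_(e2 R j) phi).
Proof.
move=> [sphi [K [cK KU phi0]]]; split; first exact: smooth_derive.
exists K; split => //; apply: derive_outside => //.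
exact: compact_closed hausdorff_plane cK.
Qed.

Lemma test_fun_pder U phi s : test_fun U phi -> test_fun U (pder s phi).
Proof. by move=> tphi; elim: s => //= j s; exact: test_fun_derive. Qed.

Lemma test_fun_sub U V phi : V `<=` U -> test_fun V phi -> test_fun U phi.
Proof.
move=> VU [sphi [K [cK KV phi0]]]; split => //.
by exists K; split => //; exact: subset_trans VU.
Qed.

Lemma test_fun_out U phi x : test_fun U phi -> ~ U x -> phi x = 0.
Proof. by move=> [_ [K [_ KU phi0]]] Ux; apply: phi0 => /KU. Qed.

Lemma test_funM U f phi : smooth f -> test_fun U phi -> test_fun U (fun x => f x * phi x).
Proof.
move=> sf [sphi [K [cK KU phi0]]]; split; first exact: smoothM.
by exists K; split => // x /phi0 ->; rewrite mulr0.
Qed.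

Lemma test_fun_lin U c phi psi : test_fun U phi -> test_fun U psi ->
  test_fun U (fun x => c * phi x + psi x).
Proof.
move=> [sphi [K [cK KU phi0]]] [spsi [K' [cK' KU' psi0]]]; split.
  by apply: smoothD => //; apply: smoothM => //; exact: smooth_cst.
exists (K `|` K'); split; first exact: compactU.
  by move=> x [/KU|/KU'].
by move=> x /not_orP[/phi0 -> /psi0 ->]; rewrite mulr0 addr0.
Qed.

Lemma test_fun0 U : test_fun U (fun=> 0).
Proof.
split; first exact: smooth_cst.
by exists set0; split => //; exact: compact0.
Qed.

Lemma test_fun_continuous U phi : test_fun U phi -> continuous phi.
Proof. by move=> [sphi _]; exact: smooth_continuous. Qed.

Lemma test_fun_bounded U phi : test_fun U phi ->
  exists2 N : R, 0 < N & forall x, ~ cbox (- N) N (- N) N x -> phi x = 0.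
Proof.
move=> [_ [K [cK _ phi0]]].
have [N N0 KN] := bounded_cboxP (compact_bounded cK).
by exists N => // x Nx; apply: phi0 => /KN.
Qed.

(** The product of the four flat functions is positive exactly on the open box, so
    1 - exp(- k _) increases to the indicator of the box as k grows. *)
Definition bump (a b c d : R) (k : nat) (x : plane R) : R :=
  1 - expR (- (k%:R * (flat 1 (x.1 - a) * flat 1 (b - x.1) * flat 1 (x.2 - c)
       * flat 1 (d - x.2)))).

Lemma flat_ge0 (t : R) : 0 <= flat 1 t.
Proof. by rewrite /flat; case: ifP => // _; rewrite hornerC mul1r expR_ge0. Qed.

Lemma flat_gt0 (t : R) : 0 < t -> 0 < flat 1 t.
Proof. by rewrite /flat => ->; rewrite hornerC mul1r expR_gt0. Qed.

Lemma flat_le0 (t : R) : t <= 0 -> flat 1 t = 0.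
Proof. by rewrite /flat leNgt => /negbTE ->. Qed.

Lemma smooth_flat p f : smooth f -> smooth (fun x => flat p (f x)).
Proof.
move=> sf; apply: (@smooth_comp R [set F | exists p, F = flat p] f) => //.
  move=> F [q ->]; exists (flat ('X^2 * (q - q^`()))); first by eexists.
  exact: flat_derive.
by exists p.
Qed.

Lemma smooth_exp f : smooth f -> smooth (fun x => expR (f x)).
Proof.
move=> sf; apply: (@smooth_comp R [set @expR R] f) => //.
by move=> F ->; exists (@expR R) => // t; exact: is_derive_expR.
Qed.

Lemma smoothN f : smooth f -> smooth (fun x => - f x).
Proof.
move=> sf; have := smoothM (smooth_cst (-1)) sf; congr smooth.
by apply/funext => x; rewrite mulN1r.
Qed.

Lemma smooth_bump a b c d k : smooth (bump a b c d k).
Proof.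
have s1 := @smooth_fst R; have s2 := @smooth_snd R.
apply: smoothD; first exact: smooth_cst.
apply: smoothN; apply: smooth_exp; apply: smoothN.
apply: smoothM; first exact: smooth_cst.
apply: smoothM; [apply: smoothM; [apply: smoothM|]|]; apply: smooth_flat.
- by apply: smoothD => //; exact: smooth_cst.
- by apply: smoothD; [exact: smooth_cst|exact: smoothN].
- by apply: smoothD => //; exact: smooth_cst.
- by apply: smoothD; [exact: smooth_cst|exact: smoothN].
Qed.

Lemma bump_out a b c d k x : ~ box a b c d x -> bump a b c d k x = 0.
Proof.
move=> nbx; rewrite /bump.
suff -> : flat 1 (x.1 - a) * flat 1 (b - x.1) * flat 1 (x.2 - c) * flat 1 (d - x.2) = 0.
  by rewrite mulr0 oppr0 expR0 subrr.
have [h1|h1] := leP (x.1 - a) 0; first by rewrite (flat_le0 h1) !mul0r.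
have [h2|h2] := leP (b - x.1) 0; first by rewrite (flat_le0 h2) mulr0 !mul0r.
have [h3|h3] := leP (x.2 - c) 0; first by rewrite (flat_le0 h3) mulr0 !mul0r.
have [h4|h4] := leP (d - x.2) 0; first by rewrite (flat_le0 h4) mulr0.
exfalso; apply: nbx; apply/boxE; split; apply/andP; split; lra.
Qed.

Lemma bump_le1 a b c d k x : 0 <= bump a b c d k x <= 1.
Proof.
rewrite /bump subr_ge0 -expR0 ler_expR oppr_le0 mulr_ge0//=; last first.
  by rewrite !mulr_ge0// flat_ge0.
by rewrite expR0 lerBlDr lerDl expR_ge0.
Qed.

Lemma bump_cvg a b c d x : box a b c d x -> bump a b c d k x @[k --> \oo] --> (1 : R).
Proof.
move=> /boxE[/andP[h1 h2] /andP[h3 h4]]; rewrite /bump.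
set y := flat 1 (x.1 - a) * _ * _ * _.
have y0 : 0 < y by rewrite !mulr_gt0// flat_gt0// subr_gt0.
rewrite -[X in _ --> X]subr0; apply: cvgB; first exact: cvg_cst.
have : expR (- (k%:R * y)) @[k --> \oo] --> (0 : R).
  have ky : (k%:R * y) @[k --> \oo] --> +oo.
    have yy : (t * y) @[t --> +oo] --> +oo by apply: (gt0_cvgMly y0); exact: cvg_id.
    exact: (cvg_comp _ _ (@cvgr_idn R) yy).
  exact: (cvg_comp _ _ ky (@cvgr_expR R)).
by [].
Qed.

Lemma test_fun_bump U a b c d k : cbox a b c d `<=` U -> test_fun U (bump a b c d k).
Proof.
move=> cU; split; first exact: smooth_bump.
exists (cbox a b c d); split => //; first exact: compact_cbox.
by move=> x ncx; apply: bump_out => /box_cbox.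
Qed.

End TestFunctions.

(** * The fundamental lemma of the calculus of variations *)

Section FundamentalLemma.
Variable R : realType.
Implicit Types (U V : set (plane R)) (f w phi : plane R -> R).
Notation mu := (@leb2 R).

Definition boxes : set (set (plane R)) :=
  [set B | exists a b c d, B = box a b c d].

(** Both coordinates are measurable for the sigma-algebra generated by the boxes,
    because a strip is a countable union of boxes; hence so is the identity. *)
Lemma boxes_generate (X : set (plane R)) : borel2 X -> <<s boxes >> X.
Proof.
move=> mX.
pose GT := g_sigma_algebraType boxes.
have m1 : @measurable_fun _ _ GT (measurableTypeR R) setT fst.
  apply: (measurability _ (RGenOpens.measurableE R)).
  move=> _ [_ [a [b ->] <-]]; rewrite setTI.
  rewrite (_ : _ @^-1` _ = \bigcup_(k in [set: nat]) box a b (- k%:R) k%:R).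
    apply: (@bigcupT_measurable _ GT) => k; apply: sub_sigma_algebra.
    by exists a, b, (- k%:R), k%:R.
  apply/seteqP; split => [x /= xab|x [k _ /boxE[xab _]]]; last by rewrite /= in_itv.
  exists (Num.truncn `|x.2|).+1 => //; apply/boxE; split.
    by move: xab; rewrite in_itv.
  by rewrite -ltr_norml truncnS_gt.
have m2 : @measurable_fun _ _ GT (measurableTypeR R) setT snd.
  apply: (measurability _ (RGenOpens.measurableE R)).
  move=> _ [_ [a [b ->] <-]]; rewrite setTI.
  rewrite (_ : _ @^-1` _ = \bigcup_(k in [set: nat]) box (- k%:R) k%:R a b).
    apply: (@bigcupT_measurable _ GT) => k; apply: sub_sigma_algebra.
    by exists (- k%:R), k%:R, a, b.
  apply/seteqP; split => [x /= xab|x [k _ /boxE[_ xab]]]; last by rewrite /= in_itv.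
  exists (Num.truncn `|x.1|).+1 => //; apply/boxE; split.
    by rewrite -ltr_norml truncnS_gt.
  by move: xab; rewrite in_itv.
have mid : @measurable_fun _ _ GT (mplane R) setT (fun x => (x.1, x.2)).
  exact: measurable_fun_pair.
have := mid measurableT X mX; rewrite setTI.
by rewrite (_ : _ @^-1` X = X)//; apply/seteqP; split => -[].
Qed.

Lemma boxI (a b c d a' b' c' d' : R) : box a b c d `&` box a' b' c' d' =
  box (Num.max a a') (Num.min b b') (Num.max c c') (Num.min d d').
Proof.
apply/seteqP; split => x.
  move=> [/boxE[/andP[h1 h2] /andP[h3 h4]] /boxE[/andP[k1 k2] /andP[k3 k4]]].
  by apply/boxE; rewrite !gt_max !lt_min h1 h2 h3 h4 k1 k2 k3 k4.
move=> /boxE; rewrite !gt_max !lt_min => -[/andP[/andP[h1 h2] /andP[h3 h4]]].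
move=> /andP[/andP[k1 k2] /andP[k3 k4]].
by split; apply/boxE; rewrite ?h1 ?h2 ?h3 ?h4 ?k1 ?k2 ?k3 ?k4.
Qed.

(** The Borel sets X on which f integrates to 0 over X and the box form a Dynkin
    system, and boxes are stable under intersection: by the pi-lambda theorem f
    integrates to 0 over every Borel subset of the box. *)
Lemma ae0_of_box_integrals (a b c d : R) f :
  mu.-integrable (box a b c d) (EFin \o f) ->
  (forall a' b' c' d', box a' b' c' d' `<=` box a b c d ->
      cbox a' b' c' d' `<=` cbox a b c d ->
      (\int[mu]_(x in box a' b' c' d') (f x)%:E = 0)%E) ->
  aeeq (box a b c d) f (fun=> 0).
Proof.
set Q := box a b c d => fQ f0.
have mQ : borel2 Q by exact: measurable_box.
pose D := [set X : set (plane R) | borel2 X /\ (\int[mu]_(x in X `&` Q) (f x)%:E = 0)%E].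
have DX : dynkin D.
  have DT : D setT.
    split; first exact: measurableT.
    by rewrite setTI; exact: f0.
  split => //.
  - move=> X [mX X0]; split; first exact: measurableC.
    have QE : Q = (X `&` Q) `|` (~` X `&` Q) by rewrite -setIUl setUv setTI.
    have [_] := DT; rewrite setTI QE (@integral_setU _ (mplane R) R (leb2_measure R)).
    + by rewrite X0 add0e -QE.
    + exact: measurableI.
    + by apply: measurableI => //; exact: measurableC.
    + by rewrite -QE; exact: measurable_int fQ.
    + apply/disj_set2P; rewrite setIACA setICr set0I//.
  - move=> F tF DF; split; first by apply: (@bigcupT_measurable _ (mplane R)) => k; have [] := DF k.
    rewrite setI_bigcupl (@integral_bigcup _ (mplane R) R (leb2_measure R)).
    + by apply: eseries0 => k _ _; have [_] := DF k.
    + apply/trivIsetP => i j _ _ ij; rewrite setIACA (trivIsetP.1 tF)// set0I//.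
    + by move=> k; apply: measurableI => //; have [] := DF k.
    + rewrite -setI_bigcupl; apply: (@integrableS _ (mplane R) R (leb2_measure R) Q) => //.
      apply: measurableI => //; apply: (@bigcupT_measurable _ (mplane R)) => k.
      by have [] := DF k.
have QI : setI_closed boxes.
  move=> _ _ [a1 [b1 [c1 [d1 ->]]]] [a2 [b2 [c2 [d2 ->]]]].
  by rewrite boxI; do 4 eexists.
have DG : <<s boxes >> `<=` D.
  apply: (lambda_system_subset QI) => //; first exact/dynkin_lambda_system.
  move=> _ [a1 [b1 [c1 [d1 ->]]]]; split; first exact: measurable_box.
  rewrite boxI; apply: f0; first by rewrite -boxI; exact: subIsetr.
  move=> x /cboxE; rewrite !ge_max !le_min => -[/andP[/andP[h1 h2] /andP[h3 h4]]].
  move=> /andP[/andP[k1 k2] /andP[k3 k4]].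
  by apply/cboxE; rewrite ?h1 ?h2 ?h3 ?h4 ?k1 ?k2 ?k3 ?k4.
have := @integral_ae_eq _ (mplane R) R (leb2_measure R) Q mQ (cst 0%E) (EFin \o f) fQ.
move=> /(_ (measurable_cst _)) H.
have : ae_eq (leb2_measure R) Q (EFin \o f) (cst 0%E).
  apply: H => E EQ mE; rewrite integral_cst// mul0e.
  have [_] := DG _ (boxes_generate mE).
  by rewrite (setIidl EQ).
by rewrite /aeeq; apply: filterS => x /[apply] -[].
Qed.

(** Dominated convergence along the bump functions of the box. *)
Lemma box_integral_of_tests U w a b c d : borel2 U -> L2 U w -> cbox a b c d `<=` U ->
  (forall phi, test_fun U phi -> l2dot U w phi = 0) ->
  (\int[mu]_(x in box a b c d) (w x)%:E = 0)%E.
Proof.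
move=> mU Lw cU w0; set B := box a b c d.
have mB : borel2 B by exact: measurable_box.
have BU : B `<=` U by apply: subset_trans cU; exact: box_cbox.
have bB : bounded_set B by apply: bounded_setS (@bounded_set_cbox R a b c d); exact: box_cbox.
have LB : L2 B w by exact: L2_sub Lw.
have mw := L2_measurable mB LB.
have iw := L2_integrable mB bB LB.
have cb k : continuous (bump a b c d k) by apply: smooth_continuous; exact: smooth_bump.
have [_ _] := @dominated_convergence _ (mplane R) R (leb2_measure R) B mB
  (fun k x => (w x * bump a b c d k x)%:E) (EFin \o w) (fun x => `|w x|%:E)
  (fun k => (measurable_EFinP _ _).2 (measurable_funM mw (@continuous_measurable_plane R _ B (cb k))))
  ((measurable_EFinP _ _).2 mw)
  ltac:(apply: aeW => x Bx; apply: cvg_EFin; [exact: nearW|rewrite -[X in _ --> X]mulr1; apply: cvgM; [exact: cvg_cst|exact: bump_cvg]])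
  ltac:(exact: (integrable_norm iw))
  ltac:(apply: aeW => x k Bx; rewrite lee_fin normrM ler_piMr//; have /andP[h1 h2] := bump_le1 a b c d k x; by rewrite ger0_norm).
have E k : (\int[mu]_(x in B) (w x * bump a b c d k x)%:E = 0)%E.
  have Lb : L2 B (bump a b c d k) by exact: L2_continuous.
  have := w0 _ (test_fun_bump k cU).
  rewrite -(@l2dot_restrict _ _ B)//; last first.
    by move=> x Ux Bx; rewrite bump_out// mulr0.
  rewrite /l2dot /Rintegral => h.
  have := integrable_fin_num mB (L2_mul mB LB Lb).
  by move=> /fineK <-; rewrite h.
under eq_fun do rewrite E.
move=> h; apply/esym; have := cvg_lim (@ereal_hausdorff R) h.
rewrite lim_cst; last exact: ereal_hausdorff.
by apply; exact: eventually_filter.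
Qed.

(** Countably many rational boxes, each with closure inside U, cover U; on each of
    them the integrals of w over all smaller boxes vanish. *)
Lemma fundamental_lemma U w : open U -> L2 U w ->
  (forall phi, test_fun U phi -> l2dot U w phi = 0) -> aeeq U w (fun=> 0).
Proof.
move=> oU Lw w0.
have mU := open_borel2 oU.
apply/aeeqP.
have : null (\bigcup_(k in [set: nat]) (inner_box U k `&` [set x | w x <> 0])).
  apply: null_bigcup => k; rewrite /inner_box.
  case: choice.unpickle => [q|]; last by rewrite set0I; exact: null0.
  case: asboolP => qU; last by rewrite set0I; exact: null0.
  apply/aeeqP; apply: ae0_of_box_integrals.
    apply: L2_integrable; [exact: measurable_box| |].
      by apply: bounded_setS (@bounded_set_cbox R _ _ _ _); exact: box_cbox.
    apply: L2_sub Lw => //; first exact: measurable_box.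
    exact: subset_trans (@box_cbox R _ _ _ _) qU.
  move=> a b c d _ cq; apply: (box_integral_of_tests mU Lw) => //.
  exact: subset_trans cq qU.
apply: nullS => x [Ux wx]; move: Ux; rewrite {1}(open_bigcup_box oU) => -[k _ kx].
by exists k.
Qed.

End FundamentalLemma.

(** * Integration by parts *)

Section IntegrationByParts.
Variable R : realType.
Implicit Types (U V K : set (plane R)) (f phi psi : plane R -> R).
Notation mu := (@leb2 R).

Lemma integral_derive_compact (F f : R -> R) (N : R) : 0 < N ->
  (forall t : R, is_derive t (1 : R) F (f t)) -> continuous f ->
  (forall t, N <= `|t| -> F t = 0) -> (forall t, N < `|t| -> f t = 0) ->
  (\int[@lebesgue_measure R]_t (f t)%:E = 0)%E.
Proof.
move=> N0 dF cf F0 f0.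
have NN : - N < N by lra.
have := @continuous_FTC2 R f F (- N) N NN (continuous_subspaceT cf).
have FN : F N = 0 by apply: F0; rewrite gtr0_norm.
have FN' : F (- N) = 0 by apply: F0; rewrite normrN gtr0_norm.
rewrite FN FN' subee//.
have cF : continuous F.
  move=> t; apply: differentiable_continuous; apply/derivable1_diffP.
  by have [] := dF t.
move=> h; rewrite -h.
- rewrite [RHS]integral_mkcond; apply: eq_integral => t _.
  rewrite patchE; case: ifPn => //.
  rewrite notin_setE /= in_itv /= => /negP; rewrite -ler_norml -ltNge => /f0 -> //.
- split; first by move=> t _; have [] := dF t.
  + by apply: cvg_at_right_filter; exact: cF.
  + by apply: cvg_at_left_filter; exact: cF.
- by move=> t _; rewrite derive1E; have [_ ->] := dF t.
Qed.

Lemma is_derive_line f (v z : plane R) (t : R) : differentiable f (t *: v + z) ->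
  is_derive t (1 : R) (fun t => f (t *: v + z)) ('D_v f (t *: v + z)).
Proof.
move=> df.
have dv : derivable f (t *: v + z) v by exact: diff_derivable.
have E : (fun h : R => h^-1 *: (((fun t => f (t *: v + z)) \o shift t) (h *: (1 : R)) - f (t *: v + z)))
   = (fun h : R => h^-1 *: ((f \o shift (t *: v + z)) (h *: v) - f (t *: v + z))).
  apply/funext => h /=; congr (_ *: (f _ - _)).
  by rewrite [h *: 1]mulr1 scalerDl addrA.
by apply: DeriveDef; [rewrite /derivable E|rewrite /derive E].
Qed.

Lemma plane_line1 (x y : R) : (x, y) = x *: e2 R ord0 + (0, y) :> plane R.
Proof. by rewrite /e2 /=; congr pair; rewrite /= ?[_ *: _]mulr1 ?[_ *: _]mulr0 ?addr0 ?add0r. Qed.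

Lemma plane_line2 (x y : R) : (x, y) = y *: e2 R (lift ord0 ord0) + (x, 0) :> plane R.
Proof. by rewrite /e2 /=; congr pair; rewrite /= ?[_ *: _]mulr1 ?[_ *: _]mulr0 ?addr0 ?add0r. Qed.

Lemma test_fun_integrable U phi : test_fun U phi -> mu.-integrable setT (EFin \o phi).
Proof.
move=> tphi; have [N N0 phi0] := test_fun_bounded tphi.
have mc : borel2 (cbox (- N) N (- N) N) by apply: measurableX; exact: measurable_itv.
have := integrable_continuous mc (@bounded_set_cbox R _ _ _ _) (test_fun_continuous tphi).
move/(@integrable_mkcond _ (mplane R) R (leb2_measure R) _ _ mc).
congr (is_true (_.-integrable _ _)); apply/funext => x.
rewrite patchE; case: ifPn => //; rewrite notin_setE => /phi0 /= -> //.
Qed.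

(** Fubini with the direction of differentiation as inner variable: the inner
    integral is that of the derivative of a compactly supported function. *)
Lemma integral_derive0 U phi j : test_fun U phi ->
  (\int[mu]_x ('D_(e2 R j) phi x)%:E = 0)%E.
Proof.
move=> tphi; have tD := test_fun_derive j tphi.
have iD := test_fun_integrable tD.
have [N N0 phi0] := test_fun_bounded tphi.
have D0 x : ~ cbox (- N) N (- N) N x -> 'D_(e2 R j) phi x = 0.
  apply: derive_outside phi0 _.
  by apply: compact_closed; [exact: hausdorff_plane|exact: compact_cbox].
have out1 (x y : R) : N < `|x| -> ~ cbox (- N) N (- N) N (x, y).
  by move=> Nx /cboxE[] /=; rewrite -ler_norml leNgt Nx.
have out2 (x y : R) : N < `|y| -> ~ cbox (- N) N (- N) N (x, y).
  by move=> Nx /cboxE[_] /=; rewrite -ler_norml leNgt Nx.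
have sphi := tphi.1.
have N1 : 0 < N + 1 by lra.
have NN (t : R) : N + 1 <= `|t| -> N < `|t| by lra.
have NN' (t : R) : N + 1 < `|t| -> N < `|t| by lra.
have cD := test_fun_continuous tD.
have j2 : j = ord0 \/ j = lift ord0 ord0.
  by case: j {tD iD D0 cD} => -[|[|//]] h; [left|right]; exact: val_inj.
rewrite /leb2; case: j2 => j2.
- rewrite -(@integral21_prod_meas1 _ _ _ _ R _ _ _ iD).
  apply: integral0_eq => y _; rewrite /fubini_G.
  apply: (integral_derive_compact N1 (F := fun x => phi (x, y))).
  + move=> t; have := @is_derive_line phi (e2 R ord0) (0, y) t (smooth_diff _ sphi).
    rewrite -plane_line1 j2.
    by under eq_fun do rewrite -plane_line1.
  + move=> t; have ct : (s, y) @[s --> t] --> ((t, y) : plane R).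
      exact: (@cvg_pair R R R (nbhs t) (nbhs t) (nbhs y) _ _ _ id (cst y) cvg_id (cvg_cst y)).
    exact: (cvg_comp _ _ ct (cD (t, y))).
  + by move=> t /NN /out1 /phi0.
  + by move=> t /NN' /out1 /D0.
- rewrite -(@integral12_prod_meas1 _ _ _ _ R _ _ _ iD).
  apply: integral0_eq => x _; rewrite /fubini_F.
  apply: (integral_derive_compact N1 (F := fun y => phi (x, y))).
  + move=> t; have := @is_derive_line phi (e2 R (lift ord0 ord0)) (x, 0) t (smooth_diff _ sphi).
    rewrite -plane_line2 j2.
    by under eq_fun do rewrite -plane_line2.
  + move=> t; have ct : (x, s) @[s --> t] --> ((x, t) : plane R).
      exact: (@cvg_pair R R R (nbhs t) (nbhs x) (nbhs t) _ _ _ (cst x) id (cvg_cst x) cvg_id).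
    exact: (cvg_comp _ _ ct (cD (x, t))).
  + by move=> t /NN /out2 /phi0.
  + by move=> t /NN' /out2 /D0.
Qed.

(** The product f phi is a test function, so the integral of its derivative is 0. *)
Lemma integration_by_parts U f phi j : borel2 U -> bounded_set U -> smooth f ->
  test_fun U phi -> l2dot U f ('D_(e2 R j) phi) = - l2dot U ('D_(e2 R j) f) phi.
Proof.
move=> mU bU sf tphi.
have tM := test_funM sf tphi.
have cf := smooth_continuous sf.
have cDf := smooth_continuous (smooth_derive j sf).
have cphi := test_fun_continuous tphi.
have tD := test_fun_derive j tphi.
have cDphi := test_fun_continuous tD.
have L g : continuous g -> L2 U g by exact: L2_continuous.
apply/eqP; rewrite -subr_eq0 opprK; apply/eqP; rewrite /l2dot.
have I1 := L2_mul mU (L _ cf) (L _ cDphi).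
have I2 := L2_mul mU (L _ cDf) (L _ cphi).
rewrite -(@RintegralD _ (mplane R) R (leb2_measure R))//.
have := integral_derive0 j tM.
have DE x : 'D_(e2 R j) (fun x => f x * phi x) x
    = f x * 'D_(e2 R j) phi x + 'D_(e2 R j) f x * phi x.
  have dphi y := smooth_diff y tphi.1.
  exact: (congr1 (fun F => F x) (deriveM_fun j (fun y => smooth_diff y sf) dphi)).
move=> h; rewrite Rintegral_mkcond.
rewrite -[0]/(fine 0%E) -h; congr fine; apply: eq_integral => x _.
rewrite DE patchE; case: ifPn => //; rewrite notin_setE => Ux.
by rewrite (test_fun_out tphi Ux) (test_fun_out tD Ux) !mulr0 addr0.
Qed.

(** The outermost derivative of phi is the first one to reach f, where it ends up
    innermost: this reverses the word s. *)
Lemma integration_by_parts_seq U f phi s : borel2 U -> bounded_set U -> smooth f ->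
  test_fun U phi ->
  l2dot U f (pder s phi) = (-1) ^+ size s * l2dot U (pder (rev s) f) phi.
Proof.
move=> mU bU; elim: s f => [|j s IH] f sf tphi; first by rewrite mul1r.
rewrite /= integration_by_parts//; last exact: test_fun_pder.
rewrite IH//; last exact: smooth_derive.
by rewrite rev_cons pder_rcons exprS mulN1r mulNr.
Qed.

End IntegrationByParts.

(** * Weak derivatives *)

Section QuadraticCS.
Variable R : realType.

(** Cauchy-Schwarz for a semi-definite form, applied below to t f + g. If a = 0 the
    polynomial is affine, hence constant; otherwise evaluate it at its minimum
    - b / a. *)
Lemma discriminant_le (a b c : R) : 0 <= a ->
  (forall t, 0 <= t ^+ 2 * a + 2 * t * b + c) -> b ^+ 2 <= a * c.
Proof.
move=> a0 h; have [a1|a1] := eqVneq a 0.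
  rewrite a1 mul0r; have [b1|b1] := eqVneq b 0; first by rewrite b1 expr0n.
  (* the affine polynomial takes the value -1 there *)
  have := h (- (c + 1) / (2 * b)); rewrite a1 mulr0 add0r.
  have -> : 2 * (- (c + 1) / (2 * b)) * b = - (c + 1) by field.
  lra.
have ap : 0 < a by rewrite lt_neqAle eq_sym a1.
have := h (- b / a).
have -> : (- b / a) ^+ 2 * a + 2 * (- b / a) * b + c = (a * c - b ^+ 2) / a by field.
by rewrite pmulr_lge0 ?invr_gt0// subr_ge0.
Qed.

End QuadraticCS.

Lemma quarter_lt (R : realFieldType) (x y z e : R) :
  x <= 2 * y + 2 * z -> z < e / 4 -> y < e / 4 -> x < e.
Proof. lra. Qed.

Lemma ler_sum_lin (R : realType) (I : finType) (c : R) (F A B : I -> R) :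
  (forall i, F i <= c * A i + c * B i) -> \sum_i F i <= c * (\sum_i A i) + c * \sum_i B i.
Proof.
move=> h; apply: (@le_trans _ _ (\sum_i (c * A i + c * B i))); first exact: ler_sum.
by rewrite big_split /= !mulr_sumr.
Qed.

Section WeakDerivative.
Variable R : realType.
Implicit Types (U V : set (plane R)) (f v w phi : plane R -> R) (s : seq 'I_2).

Lemma L2_test U phi : open U -> bounded_set U -> test_fun U phi -> L2 U phi.
Proof.
by move=> oU bU /test_fun_continuous; apply: L2_continuous => //; exact: open_borel2.
Qed.

(** All algebraic rules for the chosen derivative [wD] rest on this uniqueness. *)
Lemma weak_der_unique U s v w w' : open U -> bounded_set U ->
  is_weak_der U s v w -> is_weak_der U s v w' -> aeeq U w w'.
Proof.
move=> oU bU [Lw hw] [Lw' hw'].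
have mU := open_borel2 oU.
have : aeeq U (w \- w') (fun=> 0).
  apply: fundamental_lemma => //; first exact: L2B.
  move=> phi tphi; have Lphi := L2_test oU bU tphi.
  rewrite l2dotBl//; apply/eqP; rewrite subr_eq0; apply/eqP.
  have := hw' phi tphi; rewrite (hw phi tphi).
  by apply: mulfI; rewrite signr_eq0.
rewrite /aeeq; apply: filterS => x /[apply] /= /eqP; rewrite subr_eq0 => /eqP //.
Qed.

Definition has_wd U s v := exists w, is_weak_der U s v w.

Lemma wD_spec U s v : has_wd U s v -> is_weak_der U s v (wD U s v).
Proof. by move=> h; have := xgetPex (fun=> 0) h. Qed.

Lemma wD_L2 U s v : L2 U (wD U s v).
Proof.
rewrite /wD; case: xgetP => [w _ []//|_]; exact: L2_0.
Qed.

Lemma wD_ae U s v w : open U -> bounded_set U -> is_weak_der U s v w ->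
  aeeq U (wD U s v) w.
Proof.
by move=> oU bU h; apply: (weak_der_unique oU bU _ h); apply: wD_spec; exists w.
Qed.

Lemma is_weak_der_lin U s c v v' w w' : open U -> bounded_set U ->
  L2 U v -> L2 U v' ->
  is_weak_der U s v w -> is_weak_der U s v' w' ->
  is_weak_der U s (fun x => c * v x + v' x) (fun x => c * w x + w' x).
Proof.
move=> oU bU Lv Lv' [Lw hw] [Lw' hw']; have mU := open_borel2 oU.
split; first exact: L2_lin.
move=> phi tphi; have Lphi := L2_test oU bU tphi.
have LD := L2_test oU bU (test_fun_pder s tphi).
by rewrite !l2dot_linl// hw// hw'//; ring.
Qed.

Lemma is_weak_der_ae U s v v' w : open U -> bounded_set U ->
  L2 U v -> L2 U v' -> aeeq U v v' -> is_weak_der U s v w -> is_weak_der U s v' w.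
Proof.
move=> oU bU Lv Lv' vv [Lw hw]; split => // phi tphi.
rewrite -hw//; have LD := L2_test oU bU (test_fun_pder s tphi).
apply/esym; apply: l2dot_ae => //; first exact: open_borel2.
by rewrite /aeeq; apply: aeW.
Qed.

(** The weak derivatives of v depend on v through integrals only, so v and v' have
    the same ones and the choice made by [wD] is the same function. *)
Lemma wD_eq_ae U s v v' : open U -> bounded_set U ->
  L2 U v -> L2 U v' -> aeeq U v v' -> wD U s v = wD U s v'.
Proof.
move=> oU bU Lv Lv' vv; rewrite /wD; congr xget.
have vv' : aeeq U v' v by move: vv; rewrite /aeeq; apply: filterS => x h /h.
by apply/seteqP; split => w; exact: is_weak_der_ae.
Qed.

(** Test functions of V, extended by 0, are test functions of U. *)
Lemma is_weak_der_sub U V s v w : open U -> open V -> V `<=` U ->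
  is_weak_der U s v w -> is_weak_der V s v w.
Proof.
move=> oU oV VU [Lw hw]; split; first by apply: L2_sub Lw => //; exact: open_borel2.
move=> phi tphi.
have out psi : test_fun V psi -> forall f, l2dot V f psi = l2dot U f psi.
  move=> tpsi f; apply: l2dot_restrict => // x _ Vx.
  by rewrite (test_fun_out tpsi Vx) mulr0.
rewrite !out//; last exact: test_fun_pder.
by apply: hw; exact: test_fun_sub tphi.
Qed.

Lemma is_weak_der_smooth U s f : open U -> bounded_set U -> smooth f ->
  is_weak_der U s f (pder (rev s) f).
Proof.
move=> oU bU sf; have mU := open_borel2 oU; split.
  by apply: L2_continuous => //; apply: smooth_continuous; exact: smooth_pder.
by move=> phi tphi; exact: integration_by_parts_seq.
Qed.

Lemma has_wd_lin U s c v v' : open U -> bounded_set U -> L2 U v -> L2 U v' ->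
  has_wd U s v -> has_wd U s v' -> has_wd U s (fun x => c * v x + v' x).
Proof.
by move=> oU bU Lv Lv' [w hw] [w' hw']; eexists; exact: is_weak_der_lin hw hw'.
Qed.

Lemma wD_lin U s c v v' : open U -> bounded_set U -> L2 U v -> L2 U v' ->
  has_wd U s v -> has_wd U s v' ->
  aeeq U (wD U s (fun x => c * v x + v' x)) (fun x => c * wD U s v x + wD U s v' x).
Proof.
move=> oU bU Lv Lv' /wD_spec h /wD_spec h'; apply: wD_ae => //.
exact: is_weak_der_lin.
Qed.

Lemma subfE v v' : (v \- v') = (fun x => (-1) * v' x + v x).
Proof. by apply/funext => x; rewrite /= mulN1r addrC. Qed.

End WeakDerivative.

(** * The space H^m_0 is stable under subtraction *)

Section Hm0.
Variables (R : realType) (m : nat) (U : set (plane R)).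
Hypotheses (oU : open U) (bU : bounded_set U).
Implicit Types (v w phi : plane R -> R).

Lemma Hm_sub v w : Hm m U v -> Hm m U w -> Hm m U (v \- w).
Proof.
move=> [Lv hv] [Lw hw]; split; first exact: L2B.
by move=> s sm; rewrite subfE; apply: has_wd_lin => //; [exact: hw|exact: hv].
Qed.

Lemma Hm_test phi : test_fun U phi -> Hm m U phi.
Proof.
move=> tphi; split; first exact: L2_test.
move=> s _; exists (pder (rev s) phi); apply: is_weak_der_smooth => //.
exact: tphi.1.
Qed.

Lemma l2dot_sub_parallelogram (a b : plane R -> R) : L2 U a -> L2 U b ->
  l2dot U (a \- b) (a \- b) <= 2 * l2dot U a a + 2 * l2dot U b b.
Proof.
move=> La Lb; have mU := open_borel2 oU.
have Lab := L2B La Lb.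
rewrite l2dotBl// !l2dotBr//.
have := l2dot_ge0 U (fun x => 1 * a x + b x).
have := L2_lin 1 La Lb => Lp.
rewrite l2dot_linl// !l2dot_linr// [l2dot U b a]l2dotC; lra.
Qed.

(** The square of [Hm_norm]. *)
Definition Hm_sq v : R := \sum_(k < m.+1) l2dotT U (@wDm R k U v) (@wDm R k U v).

Lemma Hm_sq_ge0 v : 0 <= Hm_sq v.
Proof. by apply: sumr_ge0 => k _; apply: sumr_ge0 => s _; exact: l2dot_ge0. Qed.

(** From |a - b|^2 <= 2 |a|^2 + 2 |b|^2 in each component. It replaces the triangle
    inequality in [Hm0_sub], where approximation errors below eps/2 leave an
    error below eps. *)
Lemma Hm_sq_sub v w : Hm m U v -> Hm m U w ->
  Hm_sq (v \- w) <= 2 * Hm_sq v + 2 * Hm_sq w.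
Proof.
move=> [Lv hv] [Lw hw]; rewrite /Hm_sq.
apply: ler_sum_lin => k; rewrite /l2dotT; apply: ler_sum_lin => s.
have sm : (size (tval s) <= m)%N by rewrite size_tuple -ltnS; exact: ltn_ord.
rewrite /wDm; apply: le_trans (l2dot_sub_parallelogram (wD_L2 _ _ _) (wD_L2 _ _ _)).
rewrite le_eqVlt; apply/orP; left; apply/eqP.
have E : aeeq U (wD U (tval s) (v \- w)) (wD U (tval s) v \- wD U (tval s) w).
  rewrite !subfE; apply: wD_lin => //; [exact: hw|exact: hv].
apply: l2dot_ae => //; first exact: open_borel2.
- exact: wD_L2.
- by apply: L2B; exact: wD_L2.
- exact: wD_L2.
- by apply: L2B; exact: wD_L2.
Qed.

Lemma Hm0_sub v w : Hm0 m U v -> Hm0 m U w -> Hm0 m U (v \- w).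
Proof.
move=> [Hv av] [Hw aw]; split; first exact: Hm_sub.
move=> e e0; have e2 : 0 < e / 2 by lra.
have [p tp pv] := av _ e2; have [q tq qw] := aw _ e2.
exists (p \- q).
  by rewrite subfE; exact: test_fun_lin.
have Hp := Hm_sub Hv (Hm_test tp); have Hq := Hm_sub Hw (Hm_test tq).
have := Hm_sq_sub Hp Hq.
have -> : (v \- p) \- (w \- q) = (v \- w) \- (p \- q).
  by apply/funext => x /=; ring.
have sq f : Hm_norm m U f < e / 2 -> Hm_sq f < (e / 2) ^+ 2.
  rewrite /Hm_norm => h; rewrite -(sqr_sqrtr (Hm_sq_ge0 f)).
  by rewrite ltrXn2r// ?nnegrE ?sqrtr_ge0// ltW.
move=> h; rewrite /Hm_norm -/(Hm_sq _) -(ger0_norm (ltW e0)) -sqrtr_sqr ltr_sqrt ?exprn_gt0//.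
have := sq _ pv; have := sq _ qw; move: h.
have -> : (e / 2) ^+ 2 = e ^+ 2 / 4 by field.
exact: quarter_lt.
Qed.

Lemma Hm_norm0 : Hm_norm m U (fun=> 0) = 0.
Proof.
rewrite /Hm_norm big1 ?sqrtr0// => k _; rewrite /l2dotT big1// => s _.
rewrite -(l2dot0l U (fun=> 0)); apply: l2dot_ae.
- exact: open_borel2.
- exact: wD_L2.
- exact: L2_0.
- exact: wD_L2.
- exact: L2_0.
all: rewrite /wDm; apply: wD_ae => //; split; [exact: L2_0|].
all: by move=> phi _; rewrite !l2dot0l mulr0.
Qed.

Lemma Hm0_0 : Hm0 m U (fun=> 0).
Proof.
split; first exact: Hm_test (test_fun0 U).
move=> e e0; exists (fun=> 0); first exact: test_fun0.
suff -> : (fun=> 0) \- (fun=> 0) = (fun=> 0) :> (plane R -> R) by rewrite Hm_norm0.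
by apply/funext => x /=; rewrite subrr.
Qed.

End Hm0.

(** * Tensor fields with components in L^2 *)

Section L2T.
Variables (R : realType) (m : nat) (U : set (plane R)).
Hypotheses (mU : borel2 U).
Implicit Types (P Q S : tfield R m).

Definition L2T P := forall s, L2 U (P s).

Lemma l2dotTC P Q : l2dotT U P Q = l2dotT U Q P.
Proof. by apply: eq_bigr => s _; rewrite l2dotC. Qed.

Lemma l2dotT_ge0 P : 0 <= l2dotT U P P.
Proof. by apply: sumr_ge0 => s _; exact: l2dot_ge0. Qed.

Lemma l2dotT_linl c P Q S : L2T P -> L2T Q -> L2T S ->
  l2dotT U (fun s x => c * P s x + Q s x) S = c * l2dotT U P S + l2dotT U Q S.
Proof.
move=> LP LQ LS; rewrite /l2dotT mulr_sumr -big_split; apply: eq_bigr => s _.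
by rewrite l2dot_linl.
Qed.

Lemma l2dotT_linr c P Q S : L2T P -> L2T Q -> L2T S ->
  l2dotT U S (fun s x => c * P s x + Q s x) = c * l2dotT U S P + l2dotT U S Q.
Proof. by move=> *; rewrite l2dotTC l2dotT_linl// ![l2dotT U S _]l2dotTC. Qed.

Lemma l2dotT_ae P P' Q Q' : L2T P -> L2T P' -> L2T Q -> L2T Q' ->
  (forall s, aeeq U (P s) (P' s)) -> (forall s, aeeq U (Q s) (Q' s)) ->
  l2dotT U P Q = l2dotT U P' Q'.
Proof. by move=> *; apply: eq_bigr => s _; apply: l2dot_ae. Qed.

Lemma l2dotT_CS P Q : L2T P -> L2T Q -> `|l2dotT U P Q| <= l2normT U P * l2normT U Q.
Proof.
move=> LP LQ; rewrite /l2normT -sqrtrM ?l2dotT_ge0// -sqrtr_sqr ler_wsqrtr//.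
apply: discriminant_le; rewrite ?l2dotT_ge0// => t.
have LS : L2T (fun s x => t * P s x + Q s x) by move=> s; exact: L2_lin.
have := l2dotT_ge0 (fun s x => t * P s x + Q s x).
rewrite l2dotT_linl// !l2dotT_linr// [l2dotT U Q P]l2dotTC.
by congr (_ <= _); ring.
Qed.

End L2T.

Lemma l2dot_CS (R : realType) (U : set (plane R)) f g : borel2 U -> L2 U f -> L2 U g ->
  `|l2dot U f g| <= l2norm U f * l2norm U g.
Proof.
move=> mU Lf Lg; rewrite /l2norm -sqrtrM ?l2dot_ge0// -sqrtr_sqr ler_wsqrtr//.
apply: discriminant_le; rewrite ?l2dot_ge0// => t.
have LS := L2_lin t Lf Lg.
have := l2dot_ge0 U (fun x => t * f x + g x).
rewrite l2dot_linl// !l2dot_linr// [l2dot U g f]l2dotC.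
by congr (_ <= _); ring.
Qed.

(** * Triangles *)

Section Triangle.
Variable R : realType.
Implicit Types (t : 'I_3 -> plane R) (x y z : plane R).

Lemma affine_continuous (a b c : R) : continuous (fun x : plane R => a * x.1 + b * x.2 + c).
Proof.
apply: smooth_continuous; apply: smoothD; last exact: smooth_cst.
apply: smoothD; apply: smoothM; try exact: smooth_cst.
  exact: smooth_fst.
exact: smooth_snd.
Qed.

Lemma open_affine_gt0 (a b c : R) : open [set x : plane R | 0 < a * x.1 + b * x.2 + c].
Proof.
have := @open_comp _ _ (fun x : plane R => a * x.1 + b * x.2 + c) [set r | 0 < r].
apply; last exact: open_gt.
by move=> x _; exact: affine_continuous.
Qed.

Definition tdet t : R :=
  let u := t (inord 1) - t ord0 in
  let v := t (inord 2) - t ord0 in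
  u.1 * v.2 - u.2 * v.1.

(** [bary1] and [bary2], divided by the determinant, are the barycentric coordinates
    with respect to the vertices 1 and 2. *)
Definition bary1 t x : R := (t (inord 2) - t ord0).2 * (x.1 - (t ord0).1)
  - (t (inord 2) - t ord0).1 * (x.2 - (t ord0).2).

Definition bary2 t x : R := (t (inord 1) - t ord0).1 * (x.2 - (t ord0).2)
  - (t (inord 1) - t ord0).2 * (x.1 - (t ord0).1).

Lemma sum_ord3 (V : nmodType) (F : 'I_3 -> V) :
  \sum_k F k = F ord0 + F (inord 1) + F (inord 2).
Proof.
rewrite !big_ord_recl big_ord0 addr0 addrA; congr (F _ + F _ + F _).
  by apply: val_inj; rewrite /= inordK.
by apply: val_inj; rewrite /= inordK.
Qed.

Lemma triangleP t x : tdet t != 0 -> triangle t x <->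
  [/\ 0 <= bary1 t x / tdet t, 0 <= bary2 t x / tdet t &
      0 <= 1 - bary1 t x / tdet t - bary2 t x / tdet t].
Proof.
move=> d0; split.
  move=> [lam [l0 l1 xE]].
  rewrite sum_ord3 in l1; rewrite sum_ord3 in xE.
  have E1 : bary1 t x / tdet t = lam (inord 1).
    apply: (mulIf d0); rewrite divfK// xE /bary1 /tdet.
    have -> : lam ord0 = 1 - lam (inord 1) - lam (inord 2) by lra.
    case: (t ord0) (t (inord 1)) (t (inord 2)) => [a1 a2] [b1 b2] [c1 c2].
    by rewrite /= /GRing.scale /=; ring.
  have E2 : bary2 t x / tdet t = lam (inord 2).
    apply: (mulIf d0); rewrite divfK// xE /bary2 /tdet.
    have -> : lam ord0 = 1 - lam (inord 1) - lam (inord 2) by lra.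
    case: (t ord0) (t (inord 1)) (t (inord 2)) => [a1 a2] [b1 b2] [c1 c2].
    by rewrite /= /GRing.scale /=; ring.
  rewrite E1 E2; split; [exact: l0|exact: l0|].
  by have := l0 ord0; lra.
move=> [h1 h2 h3].
pose lam (k : 'I_3) := if (k == 0 :> nat)%N then 1 - bary1 t x / tdet t - bary2 t x / tdet t
  else if (k == 1 :> nat)%N then bary1 t x / tdet t else bary2 t x / tdet t.
exists lam; split.
- by move=> k; rewrite /lam; case: ifP => _ //; case: ifP.
- by rewrite sum_ord3 /lam /= !inordK//=; ring.
rewrite sum_ord3 /lam /= !inordK//=.
move: d0; rewrite /tdet /bary1 /bary2 => d0.
case: x h1 h2 h3 lam => x1 x2 _ _ _ _.
move: d0; case: (t ord0) => a1 a2; case: (t (inord 1)) => b1 b2.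
case: (t (inord 2)) => c1 c2 /= d0.
congr pair; rewrite /= /GRing.scale /=; field; exact: d0.
Qed.

(** The three strict inequalities define an open set: the coordinates are affine. *)
Lemma triangle_interior t x : tdet t != 0 -> 0 < bary1 t x / tdet t ->
  0 < bary2 t x / tdet t -> 0 < 1 - bary1 t x / tdet t - bary2 t x / tdet t ->
  (triangle t)° x.
Proof.
move=> d0 h1 h2 h3.
pose V1 := [set x | 0 < bary1 t x / tdet t].
pose V2 := [set x | 0 < bary2 t x / tdet t].
pose V3 := [set x | 0 < 1 - bary1 t x / tdet t - bary2 t x / tdet t].
have oaff (F : plane R -> R) : (exists a b c, forall x, F x = a * x.1 + b * x.2 + c) ->
    open [set x | 0 < F x].
  move=> [a [b [c FE]]]; rewrite (_ : [set x | _] = [set x | 0 < a * x.1 + b * x.2 + c]).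
    exact: open_affine_gt0.
  by apply/seteqP; split => y /=; rewrite FE.
have A1 : exists a b c, forall x, bary1 t x / tdet t = a * x.1 + b * x.2 + c.
  exists ((t (inord 2) - t ord0).2 / tdet t), (- (t (inord 2) - t ord0).1 / tdet t),
    (((t (inord 2) - t ord0).1 * (t ord0).2 - (t (inord 2) - t ord0).2 * (t ord0).1) / tdet t).
  by move=> y; rewrite /bary1; field.
have A2 : exists a b c, forall x, bary2 t x / tdet t = a * x.1 + b * x.2 + c.
  exists (- (t (inord 1) - t ord0).2 / tdet t), ((t (inord 1) - t ord0).1 / tdet t),
    (((t (inord 1) - t ord0).2 * (t ord0).1 - (t (inord 1) - t ord0).1 * (t ord0).2) / tdet t).
  by move=> y; rewrite /bary2; field.
have A3 : exists a b c, forall x, 1 - bary1 t x / tdet t - bary2 t x / tdet t = a * x.1 + b * x.2 + c.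
  have [a [b [c E]]] := A1; have [a' [b' [c' E']]] := A2.
  exists (- a - a'), (- b - b'), (1 - c - c') => y; rewrite E E'; ring.
have oV : open (V1 `&` V2 `&` V3) by apply: openI; [apply: openI|]; exact: oaff.
apply: (@interiorS _ (V1 `&` V2 `&` V3)).
  by move=> y [[k1 k2] k3]; apply/triangleP => //; split; exact: ltW.
by rewrite (interior_id _).1.
Qed.

Lemma tdet_perp (u1 u2 v1 v2 : R) : u1 * v2 - u2 * v1 != 0 ->
  [/\ (v2 != 0) || (- v1 != 0), (- u2 != 0) || (u1 != 0) &
      (v2 - u2 != 0) || (u1 - v1 != 0)].
Proof.
move=> d0; split; rewrite -negb_and; apply: contra d0 => /andP[/eqP h1 /eqP h2]; apply/eqP.
- have {}h2 : v1 = 0 by lra.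
  by rewrite h1 h2; ring.
- have {}h1 : u2 = 0 by lra.
  by rewrite h1 h2; ring.
- have {}h1 : v2 = u2 by lra.
  have {}h2 : v1 = u1 by lra.
  by rewrite h1 h2; ring.
Qed.

(** A boundary point annihilates one of the three barycentric coordinates, hence
    lies on one of three lines. *)
Lemma null_triangle_boundary t : tdet t != 0 -> null (triangle t `\` (triangle t)°).
Proof.
move=> d0; have [p1 p2 p3] := tdet_perp d0.
set u := t (inord 1) - t ord0 in p1 p2 p3; set v := t (inord 2) - t ord0 in p1 p2 p3.
have := nullU (nullU
  (null_line (v.2 * (t ord0).1 - v.1 * (t ord0).2) p1)
  (null_line (u.1 * (t ord0).2 - u.2 * (t ord0).1) p2))
  (null_line ((v.2 - u.2) * (t ord0).1 + (u.1 - v.1) * (t ord0).2 + tdet t) p3).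
apply: nullS => x [/(triangleP x d0)[h1 h2 h3] nx].
apply: contrapT => /= /not_orP[/not_orP[n1 n2] n3]; apply: nx.
apply: triangle_interior => //; rewrite lt_neqAle ?h1 ?h2 ?h3 andbT eq_sym.
- apply: contra_notN n1 => /eqP E.
  have : bary1 t x = 0 by rewrite -[LHS](divfK d0) E mul0r.
  move=> h; apply/eqP; rewrite -subr_eq0 -[X in _ == X]h /bary1 /=; apply/eqP; ring.
- apply: contra_notN n2 => /eqP E.
  have : bary2 t x = 0 by rewrite -[LHS](divfK d0) E mul0r.
  move=> h; apply/eqP; rewrite -subr_eq0 -[X in _ == X]h /bary2 /=; apply/eqP; ring.
- apply: contra_notN n3 => /eqP E.
  have : (1 - bary1 t x / tdet t - bary2 t x / tdet t) * tdet t = 0 by rewrite E mul0r.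
  rewrite !mulrBl !divfK// mul1r => h; apply/eqP.
  rewrite -subr_eq0 -oppr_eq0 -[X in _ == X]h /bary1 /bary2 /tdet /=; apply/eqP; ring.
Qed.

Lemma null_segment p q : null (@segment2 R p q).
Proof.
have [E|E] := eqVneq (q - p) 0.
  have h1 : ((1 : R) != 0) || ((0 : R) != 0) by rewrite oner_eq0.
  apply: nullS (null_line p.1 h1) => x [l _ <-].
  by rewrite E scaler0 addr0 /= mul1r mul0r addr0.
have h : ((q - p).2 != 0) || (- (q - p).1 != 0).
  rewrite -negb_and; apply: contra E => /andP[/eqP h1 /eqP h2]; apply/eqP.
  by rewrite [LHS]surjective_pairing h1; congr pair; rewrite -[LHS]opprK h2 oppr0.
apply: nullS (null_line ((q - p).2 * p.1 - (q - p).1 * p.2) h) => x [l _ <-].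
rewrite /= /GRing.scale /=; ring.
Qed.

Lemma null_point p : null [set p : plane R].
Proof.
apply: nullS (null_segment p p) => x ->; exists 0; first by rewrite /= in_itv/= lexx ler01.
by rewrite subrr scaler0 addr0.
Qed.

Lemma bounded_triangle t : bounded_set (triangle t).
Proof.
exists (\sum_k `|t k|); split; first exact: num_real.
move=> M hM x [lam [l0 l1 ->]].
apply: (@le_trans _ _ (\sum_k `|t k|)); last exact: ltW.
apply: (le_trans (ler_norm_sum _ _ _)); apply: ler_sum => k _.
rewrite normrZ ler_piMl// ger0_norm//.
by rewrite -l1 (bigD1 k)//= lerDl sumr_ge0.
Qed.

Lemma triangle_vertex t k : triangle t (t k).
Proof.
exists (fun j => (j == k)%:R); split.
- by move=> j; rewrite ler0n.
- by rewrite (bigD1 k)//= eqxx big1 ?addr0// => j /negbTE ->.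
- rewrite (bigD1 k)//= eqxx scale1r big1 ?addr0// => j /negbTE ->.
  by rewrite scale0r.
Qed.

Lemma sqr_diff_le (a b N : R) : - N <= a <= N -> - N <= b <= N ->
  (a - b) ^+ 2 <= (2 * N) ^+ 2.
Proof.
move=> /andP[h1 h2] /andP[h3 h4].
by rewrite -subr_ge0 subr_sqr mulr_ge0//; lra.
Qed.

Lemma diam_gt0 t : tdet t != 0 -> 0 < diam (triangle t).
Proof.
move=> d0.
have [N N0 TN] := bounded_cboxP (@bounded_triangle t).
have ub : has_ubound [set Defs.edist z.1 z.2 | z in triangle t `*` triangle t].
  exists (Num.sqrt ((2 * N) ^+ 2 + (2 * N) ^+ 2)) => _ [[x y] /= [/TN/cboxE xN /TN/cboxE yN] <-].
  rewrite /Defs.edist ler_wsqrtr//=.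
  case: xN yN => h1 h2 [h3 h4].
  by apply: lerD; exact: sqr_diff_le.
apply: (@lt_le_trans _ _ (Defs.edist (t (inord 1)) (t ord0))).
  rewrite /Defs.edist sqrtr_gt0 lt_neqAle addr_ge0 ?sqr_ge0// andbT eq_sym.
  apply: contra d0; rewrite paddr_eq0 ?sqr_ge0// !sqrf_eq0 => /andP[/eqP h1 /eqP h2].
  by rewrite /tdet /= h1 h2 !mul0r subrr.
apply: ub_le_sup => //.
by exists (t (inord 1), t ord0) => //; split; exact: triangle_vertex.
Qed.

End Triangle.

Section Domain.
Variables (R : realType) (U : set (plane R)).

(** A domain with Lipschitz boundary lies on one side of it. If z in the interior of
    the closure were not in U, it would be a boundary point; going down from z in
    the local chart reaches a point z' that is still in the closure of U, although
    U has no point near z'. This keeps open triangles of a mesh inside U. *)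
Lemma lipschitz_interior_closure : open U -> lipschitz_boundary U -> (closure U)° `<=` U.
Proof.
move=> oU lU z cz; apply: contrapT => Uz.
have fz : frontier U z.
  split; first exact: interior_subset cz.
  by rewrite ((interior_id _).1 oU).
have [c [s [r [L [gamma [cs r0 lip chart]]]]]] := lU z fz.
pose tt (x : plane R) := c * x.1 + s * x.2.
pose yy (x : plane R) := c * x.2 - s * x.1.
have hz : yy z <= gamma (tt z).
  rewrite leNgt; apply/negP => h; apply: Uz; apply/(chart z) => //.
  by rewrite /Defs.edist !subrr expr0n addr0 sqrtr0.
have /nbhs_ballP[e /= e0 eC] : nbhs z ((closure U)°).
  by apply: open_nbhs_nbhs; split => //; exact: open_interior.
have [tau [tau0 taue taur]] : exists tau : R, [/\ 0 < tau, tau < e & tau < r].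
  exists (Num.min e r / 2).
  have : 0 < Num.min e r by rewrite lt_min e0.
  have : Num.min e r <= e by rewrite ge_min lexx.
  have : Num.min e r <= r by rewrite ge_min lexx orbT.
  by move: (Num.min e r) => y; split; lra.
have c1 : `|c| <= 1 by rewrite -(@expr_le1 _ 2)// real_normK ?num_real// -cs lerDl sqr_ge0.
have s1 : `|s| <= 1 by rewrite -(@expr_le1 _ 2)// real_normK ?num_real// -cs lerDr sqr_ge0.
pose z' : plane R := (z.1 + tau * s, z.2 - tau * c).
have cz' : closure U z'.
  apply: interior_subset; apply: eC; split; rewrite /ball /=.
    by rewrite opprD addNKr normrN normrM gtr0_norm// (le_lt_trans _ taue)// ler_piMr// ltW.
  by rewrite opprB addrC subrK normrM gtr0_norm// (le_lt_trans _ taue)// ler_piMr// ltW.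
(* Near z' the chart places all points below the Lipschitz cone with apex z:
   this is the open set 0 < Q, 0 < A1, 0 < A2. *)
pose Q (x : plane R) := r ^+ 2 - ((x.1 - z.1) ^+ 2 + (x.2 - z.2) ^+ 2).
pose A1 (x : plane R) := yy z - (L * (tt x - tt z) + yy x).
pose A2 (x : plane R) := yy z - (- L * (tt x - tt z) + yy x).
have s1' := @smooth_fst R; have s2' := @smooth_snd R; have sc := @smooth_cst R.
have smN f : smooth f -> smooth (fun x : plane R => - f x).
  move=> sf; rewrite (_ : (fun x => _) = (fun x => -1 * f x)); first exact: smoothM.
  by apply/funext => x; rewrite mulN1r.
have stt : smooth tt by apply: smoothD; apply: smoothM.
have syy : smooth yy by apply: smoothD; [apply: smoothM|apply: smN; apply: smoothM].
have oQ : open [set x | 0 < Q x].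
  apply: (@open_comp _ _ Q [set q | 0 < q]); last exact: open_gt.
  move=> x _; apply: smooth_continuous; apply: smoothD => //; apply: smN.
  by apply: smoothD; apply: smoothX; apply: smoothD.
have oA1 : open [set x | 0 < A1 x].
  apply: (@open_comp _ _ A1 [set q | 0 < q]); last exact: open_gt.
  move=> x _; apply: smooth_continuous; apply: smoothD => //; apply: smN.
  by apply: smoothD => //; apply: smoothM => //; apply: smoothD.
have oA2 : open [set x | 0 < A2 x].
  apply: (@open_comp _ _ A2 [set q | 0 < q]); last exact: open_gt.
  move=> x _; apply: smooth_continuous; apply: smoothD => //; apply: smN.
  by apply: smoothD => //; apply: smoothM => //; apply: smoothD.
have tz' : tt z' = tt z by rewrite /tt /z' /=; ring.
have yz' : yy z' = yy z - tau.
  by rewrite /yy /z' /= -[tau in RHS]mulr1 -cs; ring.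
have nV : nbhs z' ([set x | 0 < Q x] `&` [set x | 0 < A1 x] `&` [set x | 0 < A2 x]).
  apply: open_nbhs_nbhs; split; first by apply: openI => //; exact: openI.
  split; first split.
  - have QE : Q z' = r ^+ 2 - tau ^+ 2 * (c ^+ 2 + s ^+ 2) by rewrite /Q /z' /=; ring.
    change (0 < Q z'); rewrite QE cs mulr1 subr_gt0 ltrXn2r ?nnegrE//; exact: ltW.
  - by rewrite /= /A1 tz' yz' subrr mulr0 add0r opprB addrC subrK.
  - by rewrite /= /A2 tz' yz' subrr mulr0 add0r opprB addrC subrK.
have [x [Ux [[/= Qx A1x] A2x]]] := cz' _ nV.
have xr : Defs.edist x z < r.
  rewrite /Defs.edist -[ltRHS](ger0_norm (ltW r0)) -sqrtr_sqr ltr_sqrt ?exprn_gt0//.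
  by rewrite -subr_gt0.
have := (chart x xr).1 Ux; rewrite -/(tt x) -/(yy x).
have := lip (tt x) (tt z); rewrite ler_norml => /andP[lip1 _].
move: A1x A2x; rewrite /A1 /A2; case: (ler0P (tt x - tt z)) lip1 => _; lra.
Qed.

End Domain.

(** * The open triangles of a mesh *)

Section Pieces.
Variables (R : realType) (U : set (plane R)) (n : nat) (tri : 'I_n -> 'I_3 -> plane R).

(** Up to a null set, U is the disjoint union of the open triangles: everything the
    error analysis uses of the geometry. *)
Record pieces : Prop := Pieces {
  pc_open : open U;
  pc_bounded : bounded_set U;
  pc_sub : forall i, (triangle (tri i))° `<=` U;
  pc_disj : forall i j x, (triangle (tri i))° x -> (triangle (tri j))° x -> i = j;
  pc_null : null [set x | U x /\ forall i, ~ (triangle (tri i))° x];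
  pc_diam : forall i, 0 < Defs.diam (triangle (tri i)) }.

(** Two open triangles meet in an open set; since distinct closed triangles share at
    most a vertex or an edge, that set is null, hence empty. *)
Lemma triangulation_pieces : polygonal_lipschitz_domain U -> triangulation U tri ->
  pieces.
Proof.
move=> [[oU _ _ bU] [lU _]] [nd cov conf].
have sub i : (triangle (tri i))° `<=` U.
  apply: subset_trans (lipschitz_interior_closure oU lU); apply: interiorS.
  by rewrite -cov => x Tx; exists i.
split => //.
- move=> i j x Ti Tj; apply/eqP; apply: contrapT => /negP ij.
  have oT : open ((triangle (tri i))° `&` (triangle (tri j))°).
    by apply: openI; exact: open_interior.
  apply: (open_not_null oT (conj Ti Tj)).
  have : null (triangle (tri i) `&` triangle (tri j)).
    have [->|[k [l [_ ->]]]|[k [k' [l [l' [_ _ _ ->]]]]]] := conf i j ij.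
    + exact: null0.
    + exact: null_point.
    + exact: null_segment.
  by apply: nullS => y [Ty Ty']; split; exact: interior_subset.
- have : null (\bigcup_(i in [set: 'I_n]) (triangle (tri i) `\` (triangle (tri i))°)).
    by apply: null_bigcup_ord => i; apply: null_triangle_boundary; exact: nd.
  apply: nullS => x [Ux nx].
  have : closure U x by apply: subset_closure.
  rewrite -cov => -[i _ Tx]; exists i => //; split => //; exact: nx.
- by move=> i; apply: diam_gt0; exact: nd.
Qed.

End Pieces.

(** * Piecewise derivatives and weights *)

Section Piecewise.
Variables (R : realType) (m : nat) (U : set (plane R)) (n : nat).
Variable tri : 'I_n -> 'I_3 -> plane R.
Hypothesis pcs : pieces U tri.
Implicit Types (v w f g : plane R -> R) (i : 'I_n).

Let oU := pc_open pcs.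
Let bU := pc_bounded pcs.
Let mU : borel2 U := open_borel2 (pc_open pcs).
Notation T i := ((triangle (tri i))°).
Let oT i : open (T i). Proof. exact: open_interior. Qed.
Let TU i : T i `<=` U. Proof. exact: pc_sub. Qed.
Let bT i : bounded_set (T i). Proof. exact: bounded_setS bU. Qed.
Let mT i : borel2 (T i). Proof. exact: open_borel2. Qed.

Lemma L2_piece i f : L2 U f -> L2 (T i) f.
Proof. by apply: L2_sub. Qed.

Lemma aeeq_piece i f g : aeeq U f g -> aeeq (T i) f g.
Proof. by rewrite /aeeq; apply: filterS => x h /TU /h. Qed.

Lemma ae_pieces f g : (forall i, aeeq (T i) f g) -> aeeq U f g.
Proof.
move=> h; apply/aeeqP.
have hn : null (\bigcup_(i in [set: 'I_n]) [set x | T i x /\ f x <> g x]).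
  by apply: null_bigcup_ord => i; exact/aeeqP.
apply: nullS (nullU hn (pc_null pcs)) => x [Ux fg].
have [[i Ti]|nT] := pselect (exists i, T i x); first by left; exists i.
by right; split => // i Ti; apply: nT; exists i.
Qed.

(** Both [mesh] and [wDm_pw] are of this form: 0 outside the open triangles. *)
Definition glue (F : 'I_n -> plane R -> R) (x : plane R) : R :=
  \sum_(i < n) (F i \_ (T i)) x.

Lemma glue_on F i x : T i x -> glue F x = F i x.
Proof.
move=> Tx; rewrite /glue (bigD1 i)//= patchE mem_set// big1 ?addr0// => j ji.
rewrite patchE memNset// => Tj; move/eqP: ji; apply; exact: (pc_disj pcs Tj Tx).
Qed.

Lemma glue_out F x : (forall i, ~ T i x) -> glue F x = 0.
Proof. by move=> nT; rewrite /glue big1// => i _; rewrite patchE memNset. Qed.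

Lemma L2_glue F : (forall i, L2 (T i) (F i)) -> L2 U (glue F).
Proof. by move=> LF; apply: L2_sum => i; apply: L2_patch. Qed.

Lemma wDm_pwE v (s : m.-tuple 'I_2) :
  wDm_pw tri v s = glue (fun i => wD (T i) (tval s) v).
Proof. by []. Qed.

Lemma wDm_pw_L2 v : L2T U (wDm_pw (m := m) tri v).
Proof. by move=> s; rewrite wDm_pwE; apply: L2_glue => i; exact: wD_L2. Qed.

(** The functions on which the piecewise energy product is bilinear. *)
Definition pwHm v := L2 U v /\ forall i (s : m.-tuple 'I_2), has_wd (T i) (tval s) v.

Lemma pwHm_lin c v w : pwHm v -> pwHm w -> pwHm (fun x => c * v x + w x).
Proof.
move=> [Lv hv] [Lw hw]; split; first exact: L2_lin.
by move=> i s; apply: has_wd_lin => //; exact: L2_piece.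
Qed.

Lemma pwHm_sub v w : pwHm v -> pwHm w -> pwHm (v \- w).
Proof. by move=> hv hw; rewrite subfE; exact: pwHm_lin. Qed.

Lemma pwHm_Hm v : Hm m U v -> pwHm v.
Proof.
move=> [Lv hv]; split => // i s.
have [w hw] := hv (tval s) (eq_leq (size_tuple s)).
by exists w; apply: is_weak_der_sub hw.
Qed.

Lemma pwHm_Pk k v : Pk k U tri v -> pwHm v.
Proof.
move=> [Lv hv]; split => // i s; have [c vc] := hv i.
have Lc : L2 (T i) (poly2 k c).
  by apply: L2_continuous => //; apply: smooth_continuous; exact: smooth_poly2.
exists (pder (rev (tval s)) (poly2 k c)).
apply: (is_weak_der_ae _ _ Lc) => //.
- exact: L2_piece.
- by move: vc; rewrite /aeeq; apply: filterS => x h /h.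
- by apply: is_weak_der_smooth => //; exact: smooth_poly2.
Qed.

Lemma wDm_pw_lin c v w s : pwHm v -> pwHm w ->
  aeeq U (wDm_pw (m := m) tri (fun x => c * v x + w x) s)
         (fun x => c * wDm_pw tri v s x + wDm_pw tri w s x).
Proof.
move=> [Lv hv] [Lw hw]; apply: ae_pieces => i.
have := wD_lin c (@oT i) (@bT i) (L2_piece i Lv) (L2_piece i Lw) (hv i s) (hw i s).
rewrite /aeeq; apply: filterS => x h Tx.
by rewrite !wDm_pwE !(glue_on _ Tx) h.
Qed.

(** The weak derivative on U restricts to each triangle, where it is the derivative
    of the restriction. *)
Lemma wDm_pw_Hm v s : Hm m U v -> aeeq U (wDm_pw tri v s) (@wDm R m U v s).
Proof.
move=> [Lv hv]; apply: ae_pieces => i.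
have hs := wD_spec (hv (tval s) (eq_leq (size_tuple s))).
have := wD_ae (@oT i) (@bT i) (is_weak_der_sub oU (@oT i) (@TU i) hs).
by rewrite /aeeq; apply: filterS => x h Tx; rewrite wDm_pwE (glue_on _ Tx) h.
Qed.

Lemma wDm_pw_ae v w : L2 U v -> L2 U w -> aeeq U v w ->
  wDm_pw (m := m) tri v = wDm_pw tri w.
Proof.
move=> Lv Lw vw; apply/funext => s; rewrite !wDm_pwE; congr glue.
apply/funext => i; apply: wD_eq_ae => //; try exact: L2_piece.
exact: aeeq_piece.
Qed.

Let ae_refl f : aeeq U f f. Proof. by rewrite /aeeq; exact: aeW. Qed.

Lemma a_pwC v w : a_pw m U tri v w = a_pw m U tri w v.
Proof. exact: l2dotTC. Qed.

Lemma a_pw_ge0 v : 0 <= a_pw m U tri v v.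
Proof. exact: l2dotT_ge0. Qed.

Lemma a_pw_linl c v v' w : pwHm v -> pwHm v' ->
  a_pw m U tri (fun x => c * v x + v' x) w = c * a_pw m U tri v w + a_pw m U tri v' w.
Proof.
move=> hv hv'; rewrite /a_pw -l2dotT_linl//; try exact: wDm_pw_L2.
apply: l2dotT_ae => //; try exact: wDm_pw_L2.
  by move=> s; apply: L2_lin; exact: wDm_pw_L2.
by move=> s; exact: wDm_pw_lin.
Qed.

Lemma a_pwBl v v' w : pwHm v -> pwHm v' ->
  a_pw m U tri (v \- v') w = a_pw m U tri v w - a_pw m U tri v' w.
Proof. by move=> hv hv'; rewrite subfE a_pw_linl// mulN1r addrC. Qed.

Lemma a_pw_CS v w : `|a_pw m U tri v w| <= enorm_pw m U tri v * enorm_pw m U tri w.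
Proof. by apply: l2dotT_CS => //; exact: wDm_pw_L2. Qed.

Lemma a_pw_Hm v w : Hm m U v -> Hm m U w -> a_pw m U tri v w = a_form m U v w.
Proof.
move=> hv hw; apply: l2dotT_ae => //; try exact: wDm_pw_L2.
- by move=> s; exact: wD_L2.
- by move=> s; exact: wD_L2.
- by move=> s; exact: wDm_pw_Hm.
- by move=> s; exact: wDm_pw_Hm.
Qed.

Lemma a_pw_ael v v' w : L2 U v -> L2 U v' -> aeeq U v v' ->
  a_pw m U tri v w = a_pw m U tri v' w.
Proof. by move=> Lv Lv' vv; rewrite /a_pw (wDm_pw_ae Lv Lv' vv). Qed.

Lemma enorm_pw_ae v v' : L2 U v -> L2 U v' -> aeeq U v v' ->
  enorm_pw m U tri v = enorm_pw m U tri v'.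
Proof. by move=> Lv Lv' vv; rewrite /enorm_pw /a_pw (wDm_pw_ae Lv Lv' vv). Qed.

Lemma mesh_on i x : T i x -> mesh tri x = Defs.diam (triangle (tri i)).
Proof. by move=> Tx; have := glue_on (fun i => cst (Defs.diam (triangle (tri i)))) Tx. Qed.

Lemma mesh_out x : (forall i, ~ T i x) -> mesh tri x = 0.
Proof. by move=> nT; have := glue_out (fun i => cst (Defs.diam (triangle (tri i)))) nT. Qed.

Lemma L2_weight (h : plane R -> R) f : (forall i, exists d, forall x, T i x -> h x = d) ->
  (forall x, (forall i, ~ T i x) -> h x = 0) -> L2 U f -> L2 U (fun x => h x * f x).
Proof.
move=> hT h0 Lf; have : L2 U (glue (fun i x => h x * f x)).
  apply: L2_glue => i; have [d hd] := hT i.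
  by apply: L2_eq (L2Z d (L2_piece i Lf)) => x Tx; rewrite hd.
apply: L2_eq => x Ux; have [[i Ti]|nT] := pselect (exists i, T i x).
  by rewrite (glue_on _ Ti).
have nT' i : ~ T i x by move=> Ti; apply: nT; exists i.
by rewrite glue_out// h0// mul0r.
Qed.

Lemma L2_mesh k f : (0 < k)%N -> L2 U f -> L2 U (fun x => mesh tri x ^+ k * f x).
Proof.
move=> k0; apply: L2_weight.
  by move=> i; exists (Defs.diam (triangle (tri i)) ^+ k) => x /mesh_on ->.
by move=> x /mesh_out ->; rewrite expr0n gtn_eqF.
Qed.

Lemma L2_meshV k f : (0 < k)%N -> L2 U f -> L2 U (fun x => mesh tri x ^- k * f x).
Proof.
move=> k0; apply: L2_weight.
  by move=> i; exists (Defs.diam (triangle (tri i)) ^- k) => x /mesh_on ->.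
by move=> x /mesh_out ->; rewrite expr0n gtn_eqF//= invr0.
Qed.

(** The weights cancel almost everywhere because the mesh size is positive on every
    open triangle. *)
Lemma l2dot_mesh_CS k f g : (0 < k)%N -> L2 U f -> L2 U g ->
  `|l2dot U f g| <= l2norm U (fun x => mesh tri x ^+ k * f x) *
     l2norm U (fun x => mesh tri x ^- k * g x).
Proof.
move=> k0 Lf Lg.
have Lhf := L2_mesh k0 Lf; have Lhg := L2_meshV k0 Lg.
apply: le_trans (l2dot_CS mU Lhf Lhg).
rewrite le_eqVlt; apply/orP; left; apply/eqP; congr `|_|.
rewrite /l2dot /Rintegral; congr fine.
apply: (@ae_eq_integral _ (mplane R) R (leb2_measure R)) => //.
- by apply/measurable_EFinP; apply: measurable_funM; exact: L2_measurable.
- by apply/measurable_EFinP; apply: measurable_funM; exact: L2_measurable.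
have : aeeq U (fun x => f x * g x) (fun x => (mesh tri x ^+ k * f x) * (mesh tri x ^- k * g x)).
  apply: ae_pieces => i; rewrite /aeeq; apply: aeW => x Tx.
  rewrite mulrACA divff ?mul1r// expf_neq0// (mesh_on Tx) gt_eqF//.
  exact: pc_diam pcs i.
by rewrite /aeeq; apply: filterS => x h Ux; rewrite /= h.
Qed.

End Piecewise.

(** * Two inequalities between real numbers *)

Section RealLemmas.
Variable R : rcfType.

Lemma cauchy_schwarz2 (p q x z : R) :
  p * x + q * z <= Num.sqrt (p ^+ 2 + q ^+ 2) * Num.sqrt (x ^+ 2 + z ^+ 2).
Proof.
rewrite -sqrtrM ?addr_ge0 ?sqr_ge0//.
apply: (le_trans (ler_norm _)); rewrite -sqrtr_sqr ler_wsqrtr//.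
rewrite -subr_ge0.
have -> : (p ^+ 2 + q ^+ 2) * (x ^+ 2 + z ^+ 2) - (p * x + q * z) ^+ 2
  = (p * z - q * x) ^+ 2 by ring.
exact: sqr_ge0.
Qed.

(** Here X and Z are the norms of the two orthogonal parts of the error. Both
    X + La Z and p X + q La Z are bounded, by Cauchy-Schwarz in the plane, by a
    multiple of sqrt (X^2 + Z^2), which then divides out. *)
Lemma split_estimate (X Y Z W La o p q : R) : 0 <= X -> 0 <= Z -> 0 <= o -> 0 <= q ->
  W <= X + Y -> Y <= La * Z ->
  X ^+ 2 + Z ^+ 2 <= o * W + p * X + q * Y ->
  Num.sqrt (X ^+ 2 + Z ^+ 2) <=
  Num.sqrt (1 + La ^+ 2) * o + Num.sqrt (p ^+ 2 + (q * La) ^+ 2).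
Proof.
move=> X0 Z0 o0 q0 WXY YZ h.
set S := Num.sqrt (X ^+ 2 + Z ^+ 2).
have S0 : 0 <= S by exact: sqrtr_ge0.
have S2 : S ^+ 2 = X ^+ 2 + Z ^+ 2 by rewrite sqr_sqrtr// addr_ge0 ?sqr_ge0.
have h1 : 1 * X + La * Z <= Num.sqrt (1 ^+ 2 + La ^+ 2) * S by exact: cauchy_schwarz2.
have h2 : p * X + (q * La) * Z <= Num.sqrt (p ^+ 2 + (q * La) ^+ 2) * S by exact: cauchy_schwarz2.
rewrite expr1n in h1.
have [->|Sn0] := eqVneq S 0.
  by rewrite addr_ge0// ?mulr_ge0 ?sqrtr_ge0.
have Sp : 0 < S by rewrite lt_neqAle eq_sym Sn0.
rewrite -(ler_pM2r Sp) -expr2 S2; apply: (le_trans h).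
have k1 : o * W <= o * (Num.sqrt (1 + La ^+ 2) * S).
  rewrite ler_wpM2l//; apply: le_trans h1; rewrite mul1r.
  by apply: (le_trans WXY); rewrite lerD2l.
have k2 : q * Y <= q * (La * Z) by rewrite ler_wpM2l.
rewrite mulrDl; lra.
Qed.

(** Young's inequality ap r <= (ap^2 + r^2) / 2 makes the mixed terms t cancel and
    leaves x <= ap^2 + d^2, half of the claimed bound. *)
Lemma absorb_estimate (x t d r ap : R) : x <= ap * r - t -> r ^+ 2 <= x + 2 * t + d ^+ 2 ->
  x <= 2 * (d ^+ 2 + ap ^+ 2).
Proof.
move=> h1 h2; have d0 := sqr_ge0 d; have a0 := sqr_ge0 ap.
have : 0 <= (ap - r) ^+ 2 by exact: sqr_ge0.
have -> : (ap - r) ^+ 2 = ap ^+ 2 - 2 * (ap * r) + r ^+ 2 by ring.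
lra.
Qed.

End RealLemmas.

(** * The error estimates in a semi-inner product space *)

Section SemiInner.
Variables (R : rcfType) (V : Type) (H : V -> Prop) (sub : V -> V -> V).
Variable a : V -> V -> R.
Hypothesis H_sub : forall v w, H v -> H w -> H (sub v w).
Hypothesis aC : forall v w, a v w = a w v.
Hypothesis a_ge0 : forall v, 0 <= a v v.
Hypothesis aBl : forall v v' w, H v -> H v' -> a (sub v v') w = a v w - a v' w.
Hypothesis a_CS : forall v w, `|a v w| <= Num.sqrt (a v v) * Num.sqrt (a w w).
Notation N v := (Num.sqrt (a v v)).

Lemma aBr w v v' : H v -> H v' -> a w (sub v v') = a w v - a w v'.
Proof. by move=> hv hv'; rewrite aC aBl// !(aC w). Qed.

Lemma a_sq_sub v w : H v -> H w ->
  a (sub v w) (sub v w) = a v v - 2 * a v w + a w w.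
Proof.
by move=> hv hw; rewrite aBl// !aBr// (aC w v); ring.
Qed.

Lemma N_sq v : N v ^+ 2 = a v v. Proof. by rewrite sqr_sqrtr. Qed.

Lemma N_subC v w : H v -> H w -> N (sub v w) = N (sub w v).
Proof.
by move=> hv hw; congr Num.sqrt; rewrite !a_sq_sub// (aC w v); ring.
Qed.

Lemma a_le v w : a v w <= N v * N w.
Proof. exact: le_trans (ler_norm _) (a_CS v w). Qed.

Lemma N_triangle e z w : H e -> H z -> H w ->
  N (sub e w) <= N (sub e z) + N (sub z w).
Proof.
move=> he hz hw.
rewrite -(@ler_pXn2r _ 2)// ?nnegrE ?addr_ge0 ?sqrtr_ge0//.
rewrite sqrrD; have := a_le (sub e z) (sub z w).
move: (N (sub e z) * N (sub z w)) => t; rewrite !N_sq !a_sq_sub//.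
have -> : a (sub e z) (sub z w) = a e z - a e w - a z z + a z w.
  by rewrite aBl// !aBr//; ring.
rewrite mulr2n.
move: (a e z) (a e w) (a z z) (a z w) (a e e) (a w w) => x1 x2 x3 x4 x5 x6; lra.
Qed.

Section Error.
Variables (u unc Junc z Jz : V) (Fe Fz o p q La LaJ : R).
Let e := sub u Junc.
Hypotheses (hu : H u) (hunc : H unc) (hJunc : H Junc) (hz : H z) (hJz : H Jz).
Hypothesis z_orth : a (sub e z) z = 0.
Hypothesis unc_orth : a (sub e z) unc = 0.
Hypothesis J_orth : a (sub unc Junc) z = 0.
Hypotheses (solve_u : a u e = Fe) (solve_unc : a unc z = Fz).
Hypotheses (o0 : 0 <= o) (q0 : 0 <= q).
Hypothesis residual : Fe - Fz <= o * N (sub e Jz) + p * N (sub e z) + q * N (sub z Jz).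

Let he : H e. Proof. exact: H_sub. Qed.

(** z is the orthogonal projection of e onto the discrete space. *)
Lemma pythagoras : a e e = N (sub e z) ^+ 2 + N z ^+ 2.
Proof.
move: z_orth; rewrite !N_sq aBl// a_sq_sub//.
by move: (a e e) (a e z) (a z z) => x y w h; lra.
Qed.

(** The discrete equation is accessible because e may be replaced by z in a product
    with the discrete function unc. *)
Lemma a_unc_e : a unc e = Fz.
Proof.
by move: unc_orth; rewrite aBl// aC -solve_unc [a z _]aC => /eqP; rewrite subr_eq0 => /eqP.
Qed.

(** The two equations give a(e, e) = Fe - Fz + a(unc - Junc, e), and in the last
    term e may be replaced by e - z. *)
Lemma error_a : N (sub z Jz) <= La * N z ->
  N e <= Num.sqrt (1 + La ^+ 2) * o
         + Num.sqrt ((p + N (sub unc Junc)) ^+ 2 + (q * La) ^+ 2).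
Proof.
move=> hLa; rewrite pythagoras.
apply: (split_estimate (W := N (sub e Jz)) (Y := N (sub z Jz))) => //.
- exact: N_triangle.
rewrite -pythagoras.
have E : a e e = Fe - Fz + a (sub unc Junc) (sub e z).
  rewrite aBr// J_orth subr0 {1}/e !aBl// solve_u a_unc_e; ring.
rewrite E; have := a_le (sub unc Junc) (sub e z); move: residual.
move: (N (sub e Jz)) (N (sub e z)) (N (sub z Jz)) (N (sub unc Junc)) => x1 x2 x3 x4.
move: (a _ _) => x5.
rewrite mulrDl; lra.
Qed.

(** With x = u - unc and d = unc - Junc, the equations give
    a(x, x) = Fe - Fz - a(x, d), while |e - z|^2 <= |e|^2 = |x|^2 + 2 a(x, d) + |d|^2:
    the products a(x, d) compensate each other. *)
Lemma error_b : N (sub z Jz) <= LaJ * N (sub e z) ->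
  N (sub u unc) <= Num.sqrt (2 * (N (sub unc Junc) ^+ 2 + ((1 + LaJ) * o + p + q * LaJ) ^+ 2)).
Proof.
move=> hLa; apply: ler_wsqrtr.
have tri := N_triangle he hz hJz.
have au : a (sub u unc) e = Fe - Fz by rewrite aBl// solve_u a_unc_e.
apply: (@absorb_estimate _ _ (a (sub u unc) (sub unc Junc)) _ (N (sub e z))).
- have -> : a (sub u unc) (sub u unc) = (Fe - Fz) - a (sub u unc) (sub unc Junc).
    by rewrite -au /e !aBr//; ring.
  rewrite lerD2r; apply: (le_trans residual).
  have k1 : o * N (sub e Jz) <= o * ((1 + LaJ) * N (sub e z)).
    by rewrite ler_wpM2l//; apply: (le_trans tri); rewrite mulrDl mul1r lerD2l.
  have k2 : q * N (sub z Jz) <= q * (LaJ * N (sub e z)) by rewrite ler_wpM2l.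
  move: k1 k2; move: (N (sub e Jz)) (N (sub e z)) (N (sub z Jz)) => x1 x2 x3.
  have -> : ((1 + LaJ) * o + p + q * LaJ) * x2
    = o * ((1 + LaJ) * x2) + p * x2 + q * (LaJ * x2) by ring.
  move: (o * ((1 + LaJ) * x2)) (q * (LaJ * x2)) => y1 y2; lra.
- have : N (sub e z) ^+ 2 <= a e e by rewrite pythagoras lerDl sqr_ge0.
  move=> /le_trans; apply; rewrite (N_sq (sub unc Junc)) /e.
  rewrite le_eqVlt; apply/orP; left; apply/eqP.
  rewrite !a_sq_sub// !aBl// !aBr//; ring.
Qed.

End Error.
End SemiInner.

(** * The companion operator and the residual *)

Section Companion.
Variables (R : realType) (m : nat) (m0 : (0 < m)%N) (U : set (plane R)) (n : nat).
Variables (tri : 'I_n -> 'I_3 -> plane R) (pcs : pieces U tri).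
Variables (Vnc : set (plane R -> R)) (hVnc : nc_space m U tri Vnc).
Variable kappa : R.
Variables (Inc : (plane R -> R) -> plane R -> R)
  (hInc : nc_interpolation m U tri Vnc kappa Inc).
Variables (LambdaJ : R) (J : (plane R -> R) -> plane R -> R)
  (hJ : nc_companion m U tri Vnc Inc LambdaJ J).
Implicit Types (v w : plane R -> R).

Notation a := (a_pw m U tri).
Notation N := (enorm_pw m U tri).
Notation H := (pwHm m U tri).
Notation Hm0U := (Hm0 m U).

Let oU := pc_open pcs.
Let bU := pc_bounded pcs.
Let mU : borel2 U := open_borel2 (pc_open pcs).

Lemma Vnc_Pk v : Vnc v -> Pk m U tri v.
Proof. by case: hVnc => + _ _ _; apply. Qed.

Lemma Vnc_pwHm v : Vnc v -> H v.
Proof. by move=> /Vnc_Pk; exact: (pwHm_Pk m pcs). Qed.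

Lemma Hm0_pwHm v : Hm0U v -> H v.
Proof. by move=> [hv _]; exact: (pwHm_Hm pcs hv). Qed.

Lemma Inc_Vnc v : Hm0U v -> Vnc (Inc v).
Proof. by move=> /hInc[]. Qed.

Lemma J_Hm0 v : Vnc v -> Hm0U (J v).
Proof. by move=> /(hJ.2)[]. Qed.

Lemma pwHm_L2 v : H v -> L2 U v. Proof. by case. Qed.


Lemma Inc_orth v w : Hm0U v -> Pk m U tri w -> a (v \- Inc v) w = 0.
Proof. by move=> /hInc[_ + _ _]; apply. Qed.

Lemma J_ae v : Vnc v -> aeeq U (Inc (J v)) v.
Proof. by move=> /(hJ.2)[]. Qed.

Lemma IncJ_L2 v : Vnc v -> L2 U (Inc (J v)).
Proof. by move=> /J_Hm0 /Inc_Vnc /Vnc_pwHm /pwHm_L2. Qed.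

Lemma subJ_ae v : Vnc v -> aeeq U (J v \- Inc (J v)) (J v \- v).
Proof.
move=> hv; have := J_ae hv; rewrite /aeeq; apply: filterS => x h Ux.
by rewrite /= h.
Qed.

Lemma J_pwHm v : Vnc v -> H (J v).
Proof. by move=> /J_Hm0 /Hm0_pwHm. Qed.

(** The orthogonality of the interpolation error of J v, since the interpolant of J v
    is v almost everywhere. *)
Lemma J_orth v w : Vnc v -> Pk m U tri w -> a (v \- J v) w = 0.
Proof.
move=> hv hw.
have hJv := J_pwHm hv; have hvv := Vnc_pwHm hv.
have h := Inc_orth (J_Hm0 hv) hw.
have L1 : L2 U (J v \- Inc (J v)) := L2B (pwHm_L2 hJv) (IncJ_L2 hv).
have L2' : L2 U (J v \- v) := L2B (pwHm_L2 hJv) (pwHm_L2 hvv).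
have E := a_pw_ael m pcs w L1 L2' (subJ_ae hv).
have E1 := a_pwBl pcs w hJv hvv; have E2 := a_pwBl pcs w hvv hJv.
apply: (etrans E2).
have : a (J v) w - a v w = 0 by apply: (etrans (esym E1)); apply: (etrans (esym E)).
by move=> /eqP; rewrite subr_eq0 => /eqP ->; rewrite subrr.
Qed.

Lemma enorm_pw_subC v w : H v -> H w -> N (v \- w) = N (w \- v).
Proof.
exact: (@N_subC R _ H (fun v w => v \- w) a
  (a_pwC m U tri) (fun v v' w hv hv' => a_pwBl pcs w hv hv') v w).
Qed.

(** The interpolation estimate for J v, again because J v is interpolated by v. *)
Lemma J_kappa v : Vnc v ->
  l2norm U (fun x => mesh tri x ^- m * (v x - J v x)) <= kappa * N (v \- J v).
Proof.
move=> hv.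
have hJv := J_pwHm hv; have hvv := Vnc_pwHm hv.
have [_ _ h _] := hInc (J_Hm0 hv).
have L1 : L2 U (J v \- Inc (J v)) := L2B (pwHm_L2 hJv) (IncJ_L2 hv).
have L2' : L2 U (J v \- v) := L2B (pwHm_L2 hJv) (pwHm_L2 hvv).
have L3 : L2 U (v \- J v) := L2B (pwHm_L2 hvv) (pwHm_L2 hJv).
have E1 := enorm_pw_ae m pcs L1 L2' (subJ_ae hv).
have E2 := enorm_pw_subC hJv hvv.
rewrite -E2 -E1; apply: le_trans h.
rewrite le_eqVlt; apply/orP; left; apply/eqP.
rewrite /l2norm; congr Num.sqrt.
have M1 := L2_meshV pcs m0 L1; have M2 := L2_meshV pcs m0 L2'.
have M3 := L2_meshV pcs m0 L3.
transitivity (l2dot U (fun x => mesh tri x ^- m * (J v \- v) x) (fun x => mesh tri x ^- m * (J v \- v) x)).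
  rewrite /l2dot; congr fine; apply: eq_integral => x _ /=; congr EFin.
  ring.
have ae : aeeq U (fun x => mesh tri x ^- m * (J v \- v) x)
    (fun x => mesh tri x ^- m * (J v \- Inc (J v)) x).
  by have := J_ae hv; rewrite /aeeq; apply: filterS => x hx Ux; rewrite /= hx.
exact: (l2dot_ae mU M2 M1 M2 M1 ae ae).
Qed.

(** The quotients that define [Lambda0] are bounded by LambdaJ, as the comparison of
    J with the function 0 of H^m_0 shows; so their supremum is an upper bound. *)
Lemma Lambda0_bound v : Vnc v -> N (v \- J v) <= Lambda0 m U tri Vnc J * N v.
Proof.
move=> hv.
have hvv := Vnc_pwHm hv.
have bnd w : Vnc w -> N (w \- J w) <= LambdaJ * N w.
  move=> hw; have [_ _ /(_ _ (Hm0_0 m oU bU)) h _] := hJ.2 _ hw.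
  have E : w \- (fun=> 0) = w by apply/funext => x /=; rewrite subr0.
  by rewrite E in h; exact: h.
have [vz|vnz] := pselect (aeeq U v (fun=> 0)).
  have Nv : N v = 0.
    rewrite (enorm_pw_ae m pcs (pwHm_L2 hvv) (L2_0 U) vz).
    have hz : H (fun=> 0) by apply: Hm0_pwHm; exact: Hm0_0.
    have := a_pw_linl pcs (-1) (fun=> 0) hz hz.
    rewrite /enorm_pw => h.
    suff -> : a (fun=> 0) (fun=> 0) = 0 by rewrite sqrtr0.
    have E : (fun x : plane R => -1 * (fun=> 0) x + (fun=> 0) x) = (fun=> 0) :> (plane R -> R).
      by apply/funext => x; rewrite mulr0 addr0.
    by rewrite E in h; move: h; move: (a _ _) => t; lra.
  by have := bnd _ hv; rewrite Nv !mulr0.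
have Nv0 : 0 < N v.
  rewrite lt_neqAle sqrtr_ge0 andbT eq_sym; apply/eqP => Nv0.
  by apply: vnz; case: hVnc => _ _ _ h; exact: h.
rewrite -ler_pdivrMr//.
apply: ub_le_sup; last by exists v.
exists LambdaJ => _ [w [hw wnz] <-].
have Nw0 : 0 < N w.
  rewrite lt_neqAle sqrtr_ge0 andbT eq_sym; apply/eqP => Nw0.
  by apply: wnz; case: hVnc => _ _ _ h; exact: h.
by rewrite ler_pdivrMr//; exact: bnd.
Qed.

Lemma ptvalE v c p : U p -> has_ptval U v p c -> ptval U v p = c.
Proof.
move=> Up hc; have hx : has_ptval U v p (ptval U v p).
  by have := xgetPex 0 (ex_intro _ c hc : exists x, [set c | has_ptval U v p c] x).
by apply: (ptval_unique oU Up _ hx hc); rewrite /aeeq; exact: aeW.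
Qed.

(** Interpolation keeps the point values, and E and J (I E) have the same
    interpolant. Point forces therefore do not see E - J (I E). *)
Lemma ptval_IncJ E p : Hm0U E -> U p ->
  (forall v, Hm0U v -> same_ptval U (Inc v) v p) ->
  ptval U E p = ptval U (J (Inc E)) p.
Proof.
move=> hE Up sp; have hz := Inc_Vnc hE.
have [c [c1 c2]] := sp _ hE; have [d [d1 d2]] := sp _ (J_Hm0 hz).
rewrite (ptvalE Up c2) (ptvalE Up d2).
apply: (ptval_unique oU Up _ c1 d1).
by have := J_ae hz; rewrite /aeeq; apply: filterS => x h Ux; rewrite h.
Qed.

Lemma l2dotT_wDm_pwB (q : tfield R m) v w : L2T U q -> H v -> H w ->
  l2dotT U q (wDm_pw tri (v \- w)) = l2dotT U q (wDm_pw tri v) - l2dotT U q (wDm_pw tri w).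
Proof.
move=> Lq hv hw; have Dv := wDm_pw_L2 (m := m) pcs v; have Dw := wDm_pw_L2 (m := m) pcs w.
have Dvw := wDm_pw_L2 (m := m) pcs (v \- w).
rewrite addrC -mulN1r -l2dotT_linr//; apply: l2dotT_ae => //.
- by move=> s; apply: L2_lin.
- by move=> s; rewrite /aeeq; exact: aeW.
by move=> s; rewrite subfE; exact: wDm_pw_lin.
Qed.

Variables (G : tfield R m) (hG : forall s, L2 U (G s)).
Variables (g : plane R -> R) (hg : L2 U g).

(** If no projection exists, the value is the default 0, again a piecewise
    polynomial. *)
Lemma L2proj_in_Pk k f : Pk k U tri (L2proj k U tri f).
Proof.
rewrite /L2proj; case: xgetP => [p _ []//|_].
split; first exact: L2_0.
move=> i; exists (fun _ _ => 0); rewrite /aeeq; apply: aeW => x _.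
by rewrite /poly2 big1// => j _; rewrite big1// => l _; rewrite !mul0r.
Qed.

(** Both D^m (E - I E) and D^m (J (I E) - I E) are orthogonal to piecewise constants,
    the second because I E also interpolates J (I E). Hence a piecewise constant
    field may be subtracted from G. *)
Lemma gradient_residual E : Hm0U E ->
  l2dotT U G (@wDm R m U E) - l2dotT U G (@wDm R m U (J (Inc E))) <=
  osc0T U tri G * N (E \- J (Inc E)).
Proof.
move=> hE; have hz := Inc_Vnc hE; have hJz := J_Hm0 hz.
have pE := Hm0_pwHm hE; have pz := Vnc_pwHm hz; have pJz := J_pwHm hz.
have LDw v : L2T U (@wDm R m U v) by move=> s; exact: wD_L2.
have LD v := wDm_pw_L2 (m := m) pcs v.
have conv v : Hm0U v -> l2dotT U G (@wDm R m U v) = l2dotT U G (wDm_pw tri v).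
  move=> [hv _]; apply: l2dotT_ae => // s; first by rewrite /aeeq; exact: aeW.
  have := wDm_pw_Hm pcs s hv; rewrite /aeeq; apply: filterS => x h Ux.
  by rewrite h.
rewrite (conv _ hE) (conv _ hJz).
pose q : tfield R m := fun s => L2proj 0 U tri (G s).
have qP s : Pk 0 U tri (q s) by exact: L2proj_in_Pk.
have Lq : L2T U q by move=> s; case: (qP s).
have qE v : Hm0U v -> l2dotT U q (wDm_pw tri v) = l2dotT U q (wDm_pw tri (Inc v)).
  move=> hv; have [_ _ _ /(_ q qP) h] := hInc hv.
  have E1 := l2dotT_wDm_pwB Lq (Hm0_pwHm hv) (Vnc_pwHm (Inc_Vnc hv)).
  have := etrans (esym E1) (etrans (l2dotTC _ _ _) h).
  by move/eqP; rewrite subr_eq0 => /eqP.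
have qIJ : wDm_pw (m := m) tri (Inc (J (Inc E))) = wDm_pw tri (Inc E).
  exact: (wDm_pw_ae m pcs (IncJ_L2 hz) (pwHm_L2 pz) (J_ae hz)).
have q0 : l2dotT U q (wDm_pw tri (E \- J (Inc E))) = 0.
  apply: (etrans (l2dotT_wDm_pwB Lq pE pJz)); apply/eqP; rewrite subr_eq0; apply/eqP.
  by apply: (etrans (qE _ hE)); apply/esym; rewrite (qE _ hJz) qIJ.
have EW := l2dotT_wDm_pwB hG pE pJz; rewrite -EW.
set W := wDm_pw tri (E \- J (Inc E)).
have LW : L2T U W by exact: LD.
have LGq : L2T U (fun s => G s \- q s) by move=> s; apply: L2B.
have -> : l2dotT U G W = l2dotT U (fun s => G s \- q s) W.
  rewrite -[LHS]subr0 -[X in _ - X]q0 -/W addrC -mulN1r -l2dotT_linl//.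
  apply: l2dotT_ae => //.
  - by move=> s; apply: L2_lin.
  - by move=> s; rewrite /aeeq; apply: aeW => x _; rewrite /= mulN1r addrC.
  - by move=> s; rewrite /aeeq; exact: aeW.
exact: le_trans (ler_norm _) (l2dotT_CS mU LGq LW).
Qed.

(** Split E - J (I E) = (E - I E) + (I E - J (I E)); the second part is orthogonal to
    piecewise polynomials, so there g may be replaced by its oscillation, and both
    parts satisfy the weighted estimate with constant kappa. *)
Lemma volume_residual E : Hm0U E ->
  l2dot U g E - l2dot U g (J (Inc E)) <=
  kappa * l2norm U (fun x => mesh tri x ^+ m * g x) * N (E \- Inc E)
  + kappa * osc m U tri g * N (Inc E \- J (Inc E)).
Proof.
move=> hE; have hz := Inc_Vnc hE; have hJz := J_Hm0 hz.
have LE := pwHm_L2 (Hm0_pwHm hE); have Lz := pwHm_L2 (Vnc_pwHm hz).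
have LJz := pwHm_L2 (J_pwHm hz).
pose p := L2proj m U tri g.
have pP : Pk m U tri p by exact: L2proj_in_Pk.
have Lp : L2 U p by case: pP.
have LEz := L2B LE Lz; have LzJ := L2B Lz LJz; have Lgp := L2B hg Lp.
have p0 : l2dot U p (Inc E \- J (Inc E)) = 0.
  by have [_ _ _ /(_ p pP)] := hJ.2 _ hz; rewrite l2dotC.
have -> : l2dot U g E - l2dot U g (J (Inc E)) =
   l2dot U g (E \- Inc E) + l2dot U (g \- p) (Inc E \- J (Inc E)).
  by rewrite (l2dotBl mU hg Lp LzJ) p0 !l2dotBr//; ring.
apply: lerD.
  apply: (le_trans (ler_norm _)); apply: (le_trans (l2dot_mesh_CS pcs m0 hg LEz)).
  rewrite [kappa * _]mulrC -mulrA ler_wpM2l ?sqrtr_ge0//.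
  by have [_ _ h _] := hInc hE.
apply: (le_trans (ler_norm _)); apply: (le_trans (l2dot_mesh_CS pcs m0 Lgp LzJ)).
rewrite [kappa * _]mulrC -mulrA ler_wpM2l ?sqrtr_ge0//.
exact: J_kappa.
Qed.

Variables (A : {fset plane R}) (beta : plane R -> R).
Hypothesis hA : forall p, p \in A -> U p.
Hypothesis hIncA : forall v, Hm0U v -> forall p, p \in A -> same_ptval U (Inc v) v p.

Lemma load_residual E : Hm0U E ->
  load U G g A beta E - load U G g A beta (J (Inc E)) <=
  osc0T U tri G * N (E \- J (Inc E))
  + kappa * l2norm U (fun x => mesh tri x ^+ m * g x) * N (E \- Inc E)
  + kappa * osc m U tri g * N (Inc E \- J (Inc E)).
Proof.
move=> hE; have := gradient_residual hE; have := volume_residual hE.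
rewrite /load.
have -> : \sum_(p <- A) beta p * ptval U E p = \sum_(p <- A) beta p * ptval U (J (Inc E)) p.
  apply: eq_big_seq => p pA; rewrite (ptval_IncJ hE (hA pA))// => v hv.
  exact: hIncA.
move: (l2dotT _ _ _) (l2dotT _ _ _) (l2dot _ _ _) (l2dot _ _ _) => x1 x2 x3 x4.
move: (osc0T _ _ _ * _) (_ * N (E \- Inc E)) (_ * N (Inc E \- J (Inc E))) (\sum_(p <- _) _) => y1 y2 y3 y4.
lra.
Qed.

End Companion.

Theorem theorem6p2 (R : realType) (m : nat) (hm : (0 < m)%N)
  (Omega : set (plane R)) (hOmega : polygonal_lipschitz_domain Omega)
  (n : nat) (tri : 'I_n -> 'I_3 -> plane R) (htri : triangulation Omega tri)
  (sigma : R) (hsigma : shape_regular sigma tri)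
  (Vnc : set (plane R -> R)) (hVnc : nc_space m Omega tri Vnc)
  (kappa : R) (hkappa : 0 < kappa) (Inc : (plane R -> R) -> plane R -> R)
  (hInc : nc_interpolation m Omega tri Vnc kappa Inc)
  (LambdaJ : R) (J : (plane R -> R) -> plane R -> R)
  (hJ : nc_companion m Omega tri Vnc Inc LambdaJ J)
  (G : tfield R m) (hG : forall s, L2 Omega (G s))
  (g : plane R -> R) (hg : L2 Omega g)
  (A : {fset plane R}) (beta : plane R -> R)
  (hA : forall a, a \in A -> interior_vertex Omega tri a)
  (hA1 : m = 1%N -> A = fset0)
  (hVncA : A <> fset0 -> forall vnc, Vnc vnc ->
     forall z, interior_vertex Omega tri z -> exists c, has_ptval Omega vnc z c)
  (hIncA : forall v, Hm0 m Omega v ->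
     forall a, a \in A -> same_ptval Omega (Inc v) v a)
  (u : plane R -> R) (hu : Hm0 m Omega u)
  (hu_eq : forall v, Hm0 m Omega v -> a_form m Omega u v = load Omega G g A beta v)
  (unc : plane R -> R) (hunc : Vnc unc)
  (hunc_eq : forall vnc, Vnc vnc ->
     a_pw m Omega tri unc vnc = load Omega G g A beta (J vnc)) :
  enorm m Omega (u \- J unc)
    <= Num.sqrt (1 + Lambda0 m Omega tri Vnc J ^+ 2) * osc0T Omega tri G
       + Num.sqrt
           ((kappa * l2norm Omega (fun x => mesh tri x ^+ m * g x)
             + enorm_pw m Omega tri (unc \- J unc)) ^+ 2
            + kappa ^+ 2 * Lambda0 m Omega tri Vnc J ^+ 2 * osc m Omega tri g ^+ 2)
  /\
  enorm_pw m Omega tri (u \- unc)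
    <= Num.sqrt (2 * (enorm_pw m Omega tri (unc \- J unc) ^+ 2
                      + apx Omega tri kappa LambdaJ G g ^+ 2)).

Proof.
have pcs := triangulation_pieces hOmega htri.
have oU := pc_open pcs; have bU := pc_bounded pcs.
have hJunc := J_Hm0 hJ hunc.
pose e := u \- J unc.
have he : Hm0 m Omega e by exact: Hm0_sub.
have hz := Inc_Vnc hInc he; set z := Inc e in hz.
have hJz := J_Hm0 hJ hz.
have pu := Hm0_pwHm pcs hu; have pJunc := Hm0_pwHm pcs hJunc.
have pJz := Hm0_pwHm pcs hJz; have pe := Hm0_pwHm pcs he.
have punc := Vnc_pwHm pcs hVnc hunc; have pz := Vnc_pwHm pcs hVnc hz.
have hAU p : p \in A -> Omega p by move=> /hA[].
have z_orth := Inc_orth hInc he (Vnc_Pk hVnc hz).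
have unc_orth := Inc_orth hInc he (Vnc_Pk hVnc hunc).
have J_orth := J_orth pcs hVnc hInc hJ hunc (Vnc_Pk hVnc hz).
have solve_u : a_pw m Omega tri u e = load Omega G g A beta e.
  exact: (etrans (a_pw_Hm pcs hu.1 he.1) (hu_eq _ he)).
have solve_unc := hunc_eq _ hz.
have res := load_residual hm pcs hVnc hInc hJ hG hg beta hAU hIncA he.
have o0 : 0 <= osc0T Omega tri G by exact: sqrtr_ge0.
have q0 : 0 <= kappa * osc m Omega tri g.
  by apply: mulr_ge0; [exact: ltW|exact: sqrtr_ge0].
have Hsub v w (hv : pwHm m Omega tri v) (hw : pwHm m Omega tri w) := pwHm_sub pcs hv hw.
have aC := a_pwC m Omega tri.
have aBl v v' w (hv : pwHm m Omega tri v) (hv' : pwHm m Omega tri v') := a_pwBl pcs w hv hv'.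
split.
  have La := Lambda0_bound pcs hVnc hJ hz.
  have := error_a Hsub aC (a_pw_ge0 m Omega tri) aBl (a_pw_CS m pcs) pu punc pJunc pz pJz
    z_orth unc_orth J_orth solve_u solve_unc o0 q0 res La.
  rewrite /enorm -(a_pw_Hm pcs he.1 he.1) => /le_trans; apply.
  have sq (x y t : R) : (x * y * t) ^+ 2 = x ^+ 2 * t ^+ 2 * y ^+ 2 by ring.
  by rewrite (sq kappa (osc m Omega tri g) (Lambda0 m Omega tri Vnc J)).
have LaJ : enorm_pw m Omega tri (z \- J z) <= LambdaJ * enorm_pw m Omega tri (e \- z).
  have [_ _ /(_ _ he) h _] := hJ.2 _ hz.
  have eq_le' (x y : R) : x = y -> x <= y by move=> ->.
  apply: (le_trans h); apply: eq_le'; apply: (congr1 ( *%R LambdaJ)).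
  exact: (enorm_pw_subC pcs pz pe).
have := error_b Hsub aC (a_pw_ge0 m Omega tri) aBl (a_pw_CS m pcs) pu punc pJunc pz pJz
    z_orth unc_orth solve_u solve_unc o0 q0 res LaJ.
by rewrite /apx (mulrAC kappa (osc m Omega tri g) LambdaJ).
Qed.
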